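(* Let $T \in \mathcal{B}(\mathcal{H})$ and let $g, h$ be two non-negative continuous functions on $[0, \infty)$ satisfying $g(s) h(s)=s$ for all $s\geq 0$. Then for any function $f:(0,1) \rightarrow [0,\infty)$, any $t\in(0,1)$, and any sub-multiplicative Orlicz function $\phi$, \begin{align*} \phi\left(w^2(T)\right) \leq{}& \frac{f(t)}{4(1+ f(t))} \left\|\phi\left(g^4(|T|)\right) + \phi\left(h^4(|T^*|)\right)\right\| + \frac{f(t)}{2(1+ f(t))}\, \phi\left(w\left( h^2(|T^*|) g^2(|T|)\right)\right) \\ &+ \frac{1}{2(1+ f(t))}\, \phi\left(w(T)\right) \left\|\phi \left(g^2(|T|)\right) + \phi\left(h^2(|T^*|)\right) \right\|. \end{align*}
   Context: $\mathcal{B}(\mathcal{H})$ is the algebra of bounded linear operators on a complex Hilbert space $\mathcal{H}$. For $T\in\mathcal{B}(\mathcal{H})$, $T^*$ is the adjoint, $|T|=(T^*T)^{1/2}$, $|T^*|=(TT^* )^{1/2}$, $\|T\|$ is the operator norm, $w(T)=\sup_{\|x\|=1}|\langle Tx,x\rangle|$ is the numerical radius, and $w^2(T)=(w(T))^2$. Functions of positive operators are defined by the continuous functional calculus; $g^k(|T|)=(g(|T|))^k$ and similarly for $h$. An Orlicz function is a continuous, convex, increasing function $\phi:[0,\infty)\to[0,\infty)$ with $\phi(0)=0$, $\phi(t)>0$ for all $t>0$, and $\lim_{t\to\infty}\phi(t)=\infty$. It is sub-multiplicative if $\phi(t_1t_2)\le\phi(t_1)\phi(t_2)$ for all $t_1,t_2\ge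 0$. *)

(* Defs.v *)
From HB Require Import structures.
From mathcomp Require Import all_boot all_order all_algebra.
From mathcomp Require Import sesquilinear.
From mathcomp Require Import complex.
From mathcomp Require Import all_classical all_reals all_analysis.

Set Implicit Arguments.
Unset Strict Implicit.
Unset Printing Implicit Defensive.

Import Order.TTheory GRing.Theory Num.Theory.
Import numFieldNormedType.Exports.

Local Open Scope classical_set_scope.
Local Open Scope complex_scope.
Local Open Scope ring_scope.

(* Complex Hilbert spaces: the inner product is linear in its first argument
   and conjugate-linear in its second, and it induces the complete norm. *)
HB.mixin Record isHilbert (R : realType) (H : Type)
    of CompleteNormedModule R[i] H := {
  inner : {dot H for @Num.conj R[i]} ;
  innerE : forall x : H, inner x x = `|x| ^+ 2
}.

#[short(type="hilbertType")]
HB.structure Definition Hilbert (R : realType) :=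
  {H of CompleteNormedModule R[i] H & isHilbert R H}.

Section BoundedOperators.
Context {R : realType} {H : hilbertType R}.

Definition bounded_linear (A : H -> H) : Prop :=
  linear A /\ exists M : R[i], forall x, `|A x| <= M * `|x|.

Definition bop_pred : {pred (H -> H)} := fun A => `[< bounded_linear A >].

Fact bop_pred_submod : subsemimod_closed bop_pred.
Proof.
have add : forall A B, A \in bop_pred -> B \in bop_pred -> A + B \in bop_pred.
  move=> A B /asboolP[lA [M HM]] /asboolP[lB [N HN]]; apply/asboolP; split.
    move=> a x y; rewrite /= !fctE lA lB scalerDr.
    by rewrite -!addrA; congr (_ + _); rewrite !addrA; congr (_ + _); rewrite addrC.
  exists (M + N) => x; rewrite fctE mulrDl.
  by apply: le_trans (ler_normD _ _) _; apply: lerD.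
split; first split.
- apply/asboolP; split; first by move=> a x y /=; rewrite /GRing.zero /= scaler0 addr0.
  by exists 0 => x; rewrite /GRing.zero /= normr0 mul0r.
- exact: add.
- move=> c A /asboolP[lA [M HM]]; apply/asboolP; split.
    by move=> a x y; rewrite !fctE lA scalerDr !scalerA mulrC.
  exists (`|c| * M) => x; rewrite fctE normrZ -mulrA.
  by rewrite ler_wpM2l.
Qed.

HB.instance Definition _ :=
  GRing.isSubmodClosed.Build R[i] (H -> H) bop_pred bop_pred_submod.

End BoundedOperators.

(* The algebra B(H), with the vector space structure of H -> H and
   composition as product. *)
Record bop (R : realType) (H : hilbertType R) :=
  Bop { bop_fun :> H -> H ; _ : bop_fun \in bop_pred }.

Section BopRing.
Context {R : realType} {H : hilbertType R}.

HB.instance Definition _ := [isSub for @bop_fun R H].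
HB.instance Definition _ := [Choice of bop H by <:].
HB.instance Definition _ := [SubChoice_isSubLmodule of bop H by <:].

Implicit Types A B C : bop H.

Lemma bopP A B : A =1 B -> A = B.
Proof. by move=> AB; apply/val_inj/funext. Qed.

Lemma bop_bounded A : bounded_linear A.
Proof. by apply/asboolP; exact: (valP A). Qed.

Fact bop_is_linear A : linear A.
Proof. by have [] := bop_bounded A. Qed.

HB.instance Definition _ A := GRing.isLinear.Build R[i] H H _ A (bop_is_linear A).

Fact bop_id_subproof : (id : H -> H) \in bop_pred.
Proof. by apply/asboolP; split=> //; exists 1 => x; rewrite mul1r. Qed.

Fact bop_comp_subproof A B : (A \o B : H -> H) \in bop_pred.
Proof.
apply/asboolP; split; first by move=> a x y /=; rewrite !linearP.
have [_ [M HM]] := bop_bounded A; have [_ [N HN]] := bop_bounded B.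
exists (`|M| * N) => x /=; apply: (le_trans (HM _)).
apply: (@le_trans _ _ (`|M| * `|B x|)); last by rewrite -mulrA ler_wpM2l.
have M0 : 0 <= M * `|B x| by apply: le_trans (HM _).
by rewrite -[leLHS]ger0_norm// normrM normr_id.
Qed.

Definition bop_one : bop H := Bop bop_id_subproof.
Definition bop_mul A B : bop H := Bop (bop_comp_subproof A B).

Fact bop_mulA : associative bop_mul.
Proof. by move=> A B C; apply: bopP. Qed.
Fact bop_mul1 : left_id bop_one bop_mul.
Proof. by move=> A; apply: bopP. Qed.
Fact bop_mulr1 : right_id bop_one bop_mul.
Proof. by move=> A; apply: bopP. Qed.
Fact bop_mulDl : left_distributive bop_mul +%R.
Proof. by move=> A B C; apply: bopP. Qed.
Fact bop_mulDr : right_distributive bop_mul +%R.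
Proof. by move=> A B C; apply: bopP => x /=; rewrite linearD. Qed.

HB.instance Definition _ := GRing.Zmodule_isPzRing.Build (bop H)
  bop_mulA bop_mul1 bop_mulr1 bop_mulDl bop_mulDr.

(* `|_| is R[i]-valued, hence the real parts. *)
Definition opnorm A : R :=
  sup [set complex.Re `|A x| | x in [set x : H | `|x| <= 1]].

(* On the zero space the supremum is over the empty set, and [sup set0 = 0]. *)
Definition numradius A : R :=
  sup [set complex.Re `|inner (A x) x| | x in [set x : H | `|x| = 1]].

(* The default value of [xget] plays no role: the adjoint exists by the Riesz
   representation theorem, and is unique. *)
Definition adjoint A : bop H :=
  xget 0 [set B : bop H | forall x y, inner (A x) y = inner x (B y)].

Definition spectrum A : set R[i] :=
  [set l | ~ exists B : bop H,
    (A - l *: (1 : bop H)) * B = 1 /\ B * (A - l *: (1 : bop H)) = 1].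

Definition poly_op (p : {poly R}) A : bop H :=
  \sum_(i < size p) (p`_i)%:C *: A ^+ i.

(* [is_cfc f A B]: B is the value at f of the continuous functional calculus of
   the self-adjoint operator A. As the spectrum of A is real, real functions
   and real polynomials suffice. For f continuous on the spectrum such a B exists
   and is unique, so [cfc] is f(A). *)
Definition is_cfc (f : R -> R) A B : Prop :=
  exists p : nat -> {poly R},
    {uniform [set x : R | spectrum A x%:C],
      (fun n x => (p n).[x]) @ \oo --> f} /\
    opnorm (poly_op (p n) A - B) @[n --> \oo] --> (0 : R).

Definition cfc (f : R -> R) A : bop H := xget 0 (is_cfc f A).

Definition absop A : bop H := cfc Num.sqrt (adjoint A * A).

End BopRing.

(* Monotonicity in the weak sense; strict monotonicity follows from convexity,
   phi 0 = 0 and positivity. Values of phi on negative reals are irrelevant. *)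
Record orlicz (R : realType) (phi : R -> R) : Prop := Orlicz {
  orlicz_cont : {within `[0, +oo[, continuous phi} ;
  orlicz_convex : convex_function (`[0, +oo[%classic : set R^o) phi ;
  orlicz_incr : {in `[0, +oo[ &, {homo phi : x y / x <= y}} ;
  orlicz0 : phi 0 = 0 ;
  orlicz_gt0 : forall t, 0 < t -> 0 < phi t ;
  orlicz_pinfty : phi x @[x --> +oo] --> +oo
}.

Definition submultiplicative (R : realType) (phi : R -> R) : Prop :=
  forall s t, 0 <= s -> 0 <= t -> phi (s * t) <= phi s * phi t.

(* Main.v *)
(* For a unit vector x put G = g(|T|) and K = h(|T^*|). The mixed Schwarz inequality
   gives |<Tx,x>|^2 <= <G^2 x,x> <K^2 x,x>. Split |<Tx,x>|^2 into the parts of weight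
   f/(1+f) and 1/(1+f): in the first one use Buzano's inequality for G^2 x, K^2 x and
   x, in the second one |<Tx,x>| <= w(T) and the arithmetic-geometric mean
   inequality. Convexity and submultiplicativity of phi distribute phi over the
   resulting averages and products, Jensen's inequality phi(<Ax,x>) <= <phi(A)x,x>
   turns the terms into quadratic forms bounded by operator norms, and continuity of
   phi allows passing to the supremum over x.

   The continuous functional calculus rests on |p(A)| <= sup |p| over the spectrum,
   for a self-adjoint A: if c = |p(A)| were larger, then p(A)^2 - c^2 would split over
   the complex numbers into factors A - l that are all bounded below, which
   contradicts c being the norm of p(A). *)
Require Import Defs.
From mathcomp Require Import all_boot all_order all_algebra.
From mathcomp Require Import complex ring lra.
From mathcomp Require Import all_classical all_reals all_analysis.
Import Order.TTheory GRing.Theory Num.Theory.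
Import numFieldNormedType.Exports.
Local Open Scope classical_set_scope.
Local Open Scope complex_scope.
Local Open Scope ring_scope.

(** * The inner product *)

Section InnerProduct.
Context {R : realType} {H : hilbertType R}.
Implicit Types (x y z : H) (a b : R[i]) (r s : R).

(* Norms and inner products are [R[i]]-valued; these are their real-valued versions. *)
Definition cabs a : R := complex.Re `|a|.
Definition nm x : R := complex.Re `|x|.
Definition rip x y : R := complex.Re (inner x y).

Lemma Re_le a b : a <= b -> complex.Re a <= complex.Re b.
Proof. by rewrite lecE => /andP[]. Qed.

Lemma ReD a b : complex.Re (a + b) = complex.Re a + complex.Re b.
Proof. by case: a b => [? ?] [? ?]. Qed.

Lemma ReN a : complex.Re (- a) = - complex.Re a.
Proof. by case: a. Qed.

Lemma ReMr r a : complex.Re (r%:C * a) = r * complex.Re a.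
Proof. by case: a => u v /=; rewrite mul0r subr0. Qed.

Lemma ReJ a : complex.Re (Num.conj a) = complex.Re a.
Proof. by case: a. Qed.

Lemma cabsE a : `|a| = (cabs a)%:C.
Proof. by rewrite /cabs RRe_real// ger0_real. Qed.

Lemma cabs_ge0 a : 0 <= cabs a.
Proof. exact: (Re_le _ _ (normr_ge0 a)). Qed.

Lemma cabsr r : cabs r%:C = `|r|.
Proof. by rewrite /cabs normc_def/= expr0n/= addr0 sqrtr_sqr. Qed.

Lemma cabs_sq a : cabs a ^+ 2 = complex.Re a ^+ 2 + complex.Im a ^+ 2.
Proof. by rewrite /cabs normc_def/= sqr_sqrtr// addr_ge0// sqr_ge0. Qed.

Lemma Re_le_cabs a : `|complex.Re a| <= cabs a.
Proof.
rewrite -(ler_pXn2r (n := 2)) ?nnegrE ?cabs_ge0//.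
by rewrite cabs_sq real_normK ?num_real// lerDl sqr_ge0.
Qed.

Lemma cabsD a b : cabs (a + b) <= cabs a + cabs b.
Proof. by rewrite -ReD; apply: Re_le; apply: ler_normD. Qed.

Lemma cabs_gt0 a : a != 0 -> 0 < cabs a.
Proof.
move=> a0; rewrite lt_neqAle cabs_ge0 andbT eq_sym.
by apply: contra a0 => /eqP ca; rewrite -normr_eq0 cabsE ca.
Qed.

Lemma nmE x : `|x| = (nm x)%:C.
Proof. by rewrite /nm RRe_real// ger0_real. Qed.

Lemma nm_ge0 x : 0 <= nm x.
Proof. exact: (Re_le _ _ (normr_ge0 x)). Qed.

Lemma nm0 : nm 0 = 0 :> R.
Proof. by rewrite /nm normr0. Qed.

Lemma nm_eq0 x : nm x = 0 -> x = 0.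
Proof. by move=> x0; apply/eqP; rewrite -normr_eq0 nmE x0. Qed.

Lemma nmD x y : nm (x + y) <= nm x + nm y.
Proof. by rewrite -ReD; apply: Re_le; apply: ler_normD. Qed.

Lemma nmN x : nm (- x) = nm x.
Proof. by rewrite /nm normrN. Qed.

Lemma nmBC x y : nm (x - y) = nm (y - x).
Proof. by rewrite -nmN opprB. Qed.

Lemma nmZ a x : nm (a *: x) = cabs a * nm x.
Proof. by rewrite /nm normrZ cabsE ReMr. Qed.

Lemma nmZr r x : nm (r%:C *: x) = `|r| * nm x.
Proof. by rewrite nmZ cabsr. Qed.

Lemma ripxx x : rip x x = nm x ^+ 2.
Proof. by rewrite /rip innerE nmE -rmorphXn. Qed.

Lemma innerC x y : inner x y = Num.conj (inner y x).
Proof. by rewrite hermC /= expr0 mul1r. Qed.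

Lemma innerDl x y z : inner (x + y) z = inner x z + inner y z.
Proof. by rewrite linearDl. Qed.

Lemma innerDr x y z : inner x (y + z) = inner x y + inner x z.
Proof. by rewrite linearDr. Qed.

Lemma innerNl x y : inner (- x) y = - inner x y.
Proof. by rewrite linearNl. Qed.

Lemma innerNr x y : inner x (- y) = - inner x y.
Proof. by rewrite linearNr. Qed.

Lemma inner0l y : inner 0 y = 0.
Proof. by rewrite linear0l. Qed.

Lemma inner0r y : inner y 0 = 0.
Proof. by rewrite linear0r. Qed.

Lemma innerZl a x y : inner (a *: x) y = a * inner x y.
Proof. by rewrite linearZl_LR. Qed.

Lemma innerZr a x y : inner x (a *: y) = Num.conj a * inner x y.
Proof. by rewrite linearZr_LR. Qed.

Lemma conj_real r : Num.conj (r%:C) = r%:C :> R[i].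
Proof. exact: conjc_real. Qed.

Lemma ripC x y : rip x y = rip y x.
Proof. by rewrite /rip innerC ReJ. Qed.

Lemma ripDl x y z : rip (x + y) z = rip x z + rip y z.
Proof. by rewrite /rip innerDl ReD. Qed.

Lemma ripNl x y : rip (- x) y = - rip x y.
Proof. by rewrite /rip innerNl ReN. Qed.

Lemma ripZl r x y : rip (r%:C *: x) y = r * rip x y.
Proof. by rewrite /rip innerZl ReMr. Qed.

Lemma ripDr x y z : rip x (y + z) = rip x y + rip x z.
Proof. by rewrite ripC ripDl !(ripC x). Qed.

Lemma ripNr x y : rip x (- y) = - rip x y.
Proof. by rewrite ripC ripNl ripC. Qed.

Lemma ripZr r x y : rip x (r%:C *: y) = r * rip x y.
Proof. by rewrite ripC ripZl ripC. Qed.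

Lemma rip0l y : rip 0 y = 0.
Proof. by rewrite /rip inner0l. Qed.

Definition ripE := (ripDl, ripDr, ripNl, ripNr, ripZl, ripZr).

(** Cauchy-Schwarz, from [nm (x - t y) ^+ 2 >= 0] at the real t for which this square is
    smallest. *)
Lemma rip_le x y : rip x y <= nm x * nm y.
Proof.
have [->|y0] := eqVneq y 0; first by rewrite ripC rip0l nm0 mulr0.
have ny : 0 < nm y ^+ 2.
  rewrite exprn_gt0// lt_neqAle nm_ge0 andbT eq_sym.
  by apply: contra y0 => /eqP/nm_eq0 ->.
set t := rip x y / nm y ^+ 2.
have := sqr_ge0 (nm (x - t%:C *: y)); rewrite -ripxx !ripE (ripC y) !ripxx.
have tE : t * nm y ^+ 2 = rip x y by rewrite /t divfK// gt_eqF.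
rewrite tE => h0.
have {}h0 : t * rip x y <= nm x ^+ 2 by nra.
have [r0|r0] := leP (rip x y) 0.
  by rewrite (le_trans r0)// mulr_ge0 ?nm_ge0.
rewrite -(ler_pXn2r (n := 2)) ?nnegrE ?mulr_ge0 ?nm_ge0 ?(ltW r0)// exprMn.
by have := ler_wpM2r (ltW ny) h0; rewrite mulrAC tE -expr2.
Qed.

(** A unimodular factor turns a modulus into a real part, so that bounds on [rip] carry over to
    [cabs] of [inner]. *)
Lemma phase a : exists2 c : R[i], cabs c = 1 & c * a = (cabs a)%:C.
Proof.
have [->|a0] := eqVneq a 0.
  by exists 1; [rewrite /cabs normr1|rewrite mulr0 /cabs normr0].
have na0 : `|a| != 0 by rewrite normr_eq0.
exists (`|a| / a); last by rewrite divfK// cabsE.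
by rewrite /cabs normf_div normr_id divff.
Qed.

Lemma inner_le x y : cabs (inner x y) <= nm x * nm y.
Proof.
have [c c1 cE] := phase (inner x y).
have -> : cabs (inner x y) = rip (c *: x) y by rewrite /rip innerZl cE.
by rewrite (le_trans (rip_le _ _))// nmZ c1 mul1r.
Qed.

Lemma rip_eq x y : (forall v, rip x v = rip y v) -> x = y.
Proof.
move=> xy; apply/eqP; rewrite -subr_eq0; apply/eqP/nm_eq0/eqP.
by rewrite -sqrf_eq0 -ripxx ripDl ripNl xy subrr.
Qed.

(* The imaginary part of an inner product is a real part: Im z = - Re(i z). *)
Lemma linear_Re_eq (F G : H -> R[i]) :
    (forall a v, F (a *: v) = a * F v) -> (forall a v, G (a *: v) = a * G v) ->
  (forall v, complex.Re (F v) = complex.Re (G v)) -> forall v, F v = G v.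
Proof.
move=> hF hG FG v; have := FG ('i *: v); rewrite hF hG => FGi.
have := FG v; move: FGi; case: (F v) (G v) => [u1 u2] [v1 v2] /=.
by rewrite !mul1r !mul0r !add0r => /oppr_inj -> ->.
Qed.

End InnerProduct.

(** * Completeness and the Lax-Milgram theorem *)

Section Complete.
Context {R : realType} {H : hilbertType R}.

Lemma nm_complete (u : nat -> H) :
    (forall e : R, 0 < e -> exists N, forall m n, (N <= m)%N -> (N <= n)%N ->
      nm (u m - u n) <= e) ->
  exists l, forall e : R, 0 < e -> exists N, forall n, (N <= n)%N ->
    nm (u n - l) <= e.
Proof.
move=> uC.
have uc : cvg (u @ \oo).
  apply: cauchy_cvg; apply: cauchy_exP => e e0.
  (* Positive elements of [R[i]] are real, so the radius e is given by its real part. *)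
  have e2 : e = (complex.Re e)%:C by rewrite RRe_real// gtr0_real.
  have e3 : 0 < complex.Re e / 2 by rewrite divr_gt0// -ltcR -e2.
  have [N hN] := uC _ e3.
  exists (u N); exists N => // n /= Nn.
  rewrite -ball_normE /= nmE e2 ltcR.
  by rewrite (le_lt_trans (hN _ _ _ _))// ltr_pdivrMr// ltr_pMr ?ltr1n// -ltcR -e2.
exists (lim (u @ \oo)) => e e0.
have /cvgrPdist_le := uc => /(_ e%:C); rewrite ltcR => /(_ e0)[N _ hN].
by exists N => n Nn; have := hN n Nn; rewrite nmE lecR nmBC.
Qed.

Lemma bop_ex (F : H -> H) (L : R) :
  linear F -> (forall x, nm (F x) <= L * nm x) -> exists B : bop H, B =1 F.
Proof.
move=> Fl FL; suff FP : F \in bop_pred by exists (Bop FP).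
by apply/asboolP; split => //; exists L%:C => x; rewrite !nmE -rmorphM lecR.
Qed.

Lemma bop_bound (A : bop H) : exists2 L : R, 0 <= L & forall x, nm (A x) <= L * nm x.
Proof.
have [_ [M AM]] := bop_bounded A; exists (cabs M); first exact: cabs_ge0.
move=> x; rewrite -lecR -nmE rmorphM /= -cabsE -nmE (le_trans (AM x))//.
have := le_trans (normr_ge0 _) (AM x).
by move=> /ger0_norm <-; rewrite normrM normr_id.
Qed.

(** Scaling a nonzero x by the inverse of its norm reduces the bound to the unit ball; real
    homogeneity is enough for this. *)
Lemma nm_lin (F : H -> H) (L : R) : (forall r x, F (r%:C *: x) = r%:C *: F x) ->
  (forall x, nm x <= 1 -> nm (F x) <= L) -> forall x, nm (F x) <= L * nm x.
Proof.
move=> FZ FL x; have [x0|x0] := eqVneq (nm x) 0.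
  have F0 : F 0 = 0 by have := FZ 0 0; rewrite (_ : 0%:C = 0)// !scale0r.
  by rewrite (nm_eq0 x x0) F0 nm0 mulr0.
have xp : 0 < nm x by rewrite lt_neqAle eq_sym x0 nm_ge0.
have := FL ((nm x)^-1%:C *: x); rewrite FZ !nmZr.
rewrite ger0_norm ?invr_ge0 ?nm_ge0// mulVf// => /(_ (lexx _)).
by rewrite ler_pdivrMl// mulrC.
Qed.

Lemma opnorm_has_sup (A : bop H) :
  has_sup [set complex.Re `|A x| | x in [set x : H | `|x| <= 1]].
Proof.
split; first by exists (nm (A 0)), 0; rewrite //= normr0.
have [L L0 AL] := bop_bound A; exists L => _ [x /= x1 <-].
apply: le_trans (AL x) _; rewrite ler_piMr//.
by rewrite -lecR -nmE.
Qed.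

Lemma opnorm_ge0 (A : bop H) : 0 <= opnorm A.
Proof.
apply: ub_le_sup; first exact: (opnorm_has_sup A).2.
by exists 0; rewrite /= ?normr0 // linear0 normr0.
Qed.

Lemma opnormP (A : bop H) x : nm (A x) <= opnorm A * nm x.
Proof.
move: x; apply: nm_lin => [r x|x x1]; first by rewrite linearZ.
apply: ub_le_sup; first exact: (opnorm_has_sup A).2.
by exists x => //=; rewrite nmE lecR.
Qed.

Lemma opnorm_le (A : bop H) c : 0 <= c ->
  (forall x, nm (A x) <= c * nm x) -> opnorm A <= c.
Proof.
move=> c0 Ac; apply: ge_sup; first exact: (opnorm_has_sup A).1.
move=> _ [x /= x1 <-]; apply: le_trans (Ac x) _; rewrite ler_piMr//.
by rewrite -lecR -nmE.
Qed.

Lemma invr_small (e : R) : 0 < e ->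
  exists N, forall n, (N <= n)%N -> n.+1%:R^-1 <= e.
Proof.
move=> e0; exists (Num.truncn e^-1) => n Nn.
rewrite invf_ple ?posrE// (le_trans (ltW (truncnS_gt _)))//.
by rewrite ler_nat ltnS.
Qed.

(* The minimiser of the energy [<Sx,x> - 2 F x] solves the variational problem. *)
Lemma lax_milgram (S : bop H) (F : H -> R) (c K : R) :
    (forall x y, rip (S x) y = rip x (S y)) ->
    0 < c -> (forall x, c * nm x ^+ 2 <= rip (S x) x) ->
    (forall x y, F (x + y) = F x + F y) -> (forall r x, F (r%:C *: x) = r * F x) ->
    (forall x, F x <= K * nm x) ->
  exists x, forall v, rip (S x) v = F v.
Proof.
move=> Ss c0 Sc FD FZ FK.
have [L L0 SL] := bop_bound S.
pose J x : R := rip (S x) x - 2 * F x.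
have SrD x y : S (x + y) = S x + S y by rewrite linearD.
have SrZ r x : S (r%:C *: x) = r%:C *: S x by rewrite linearZ.
have Sq x v : rip (S v) x = rip (S x) v by rewrite Ss ripC.
have Jlin u v r : J (u + r%:C *: v) = J u + 2 * r * (rip (S u) v - F v)
    + r ^+ 2 * rip (S v) v.
  rewrite /J SrD SrZ FD FZ !ripE (Sq u v) Sq; ring.
(* Completing the square in [c * nm x ^+ 2 - 2 * K * nm x] bounds the energy from below. *)
have Jge x : - (K ^+ 2 / c) <= J x.
  rewrite /J; have := FK x; have := Sc x.
  have : 0 <= (c * nm x - K) ^+ 2 / c by rewrite divr_ge0 ?sqr_ge0// ltW.
  have -> : (c * nm x - K) ^+ 2 / c = c * nm x ^+ 2 - 2 * K * nm x + K ^+ 2 / c.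
    by field; rewrite gt_eqF.
  lra.
pose d := inf (range J).
have Ji : has_inf (range J).
  by split; [exists (J 0); exists 0|exists (- (K ^+ 2 / c)) => _ [x _ <-]].
have Jd x : d <= J x by apply: ge_inf; [exact: Ji.2|exists x].
have /choice[u uP] n : exists x, J x <= d + n.+1%:R^-1.
  have n0 : 0 < n.+1%:R^-1 :> R by rewrite invr_gt0.
  have [_ [x _ <-] xd] := inf_adherent n0 Ji.
  by exists x; exact: ltW.
(* The midpoint of [u m] and [u n] has energy at least d; by the parallelogram argument this makes
   the minimising sequence Cauchy. *)
have ucauchy m n : nm (u m - u n) ^+ 2 <= 2 / c * (m.+1%:R^-1 + n.+1%:R^-1).
  have h1 := uP m; have h2 := uP n.
  have h3 := Jd (u n + (2^-1)%:C *: (u m - u n)).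
  have h4 := Jlin (u n) (u m - u n) 1; rewrite scale1r addrC subrK in h4.
  have h5 := Sc (u m - u n); rewrite Jlin in h3.
  rewrite mulrAC ler_pdivlMr//.
  have E : 2^-1 ^+ 2 = 4^-1 :> R by field.
  rewrite E expr1n mulr1 divff// in h3 h4; rewrite mulrC (le_trans h5)//.
  have aux (j1 j2 t s a b : R) : j1 <= d + a -> j2 <= d + b ->
    d <= j2 + 1 * t + 4^-1 * s -> j1 = j2 + 2 * t + 1 * s -> s <= 2 * (a + b).
    lra.
  exact: aux h1 h2 h3 h4.
(* Moving [u n] along v by the optimal step [- (q / rip (S v) v)] lowers the energy by
   [q ^+ 2 / rip (S v) v], which cannot exceed its distance to the infimum. *)
have eqn n v : (rip (S (u n)) v - F v) ^+ 2 <= n.+1%:R^-1 * (rip (S v) v).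
  set q := rip _ _ - _; have h1 := uP n.
  have [S0|S0] := eqVneq (rip (S v) v) 0.
    have := Sc v; rewrite S0 => v0.
    have vz : v = 0.
      apply/nm_eq0/eqP; rewrite -sqrf_eq0 eq_le sqr_ge0 andbT.
      by rewrite -(pmulr_rle0 _ c0).
    have F0 : F 0 = 0 by have := FZ 0 v; rewrite scale0r mul0r.
    by rewrite /q vz ripC rip0l F0 subrr expr0n/= mulr0.
  have Sp : 0 < rip (S v) v.
    by rewrite lt_neqAle eq_sym S0/= (le_trans _ (Sc v))// mulr_ge0 ?sqr_ge0 ?ltW.
  have h2 := Jd (u n + (- (q / rip (S v) v))%:C *: v).
  rewrite Jlin -/q in h2.
  have E : q / rip (S v) v * q = q ^+ 2 / rip (S v) v by rewrite mulrAC.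
  have E2 : (q / rip (S v) v) ^+ 2 * rip (S v) v = q ^+ 2 / rip (S v) v.
    by field.
  have aux (j z a : R) : d <= j + - (2 * z) + z -> j <= d + a -> z <= a by lra.
  have h3 : q ^+ 2 / rip (S v) v <= n.+1%:R^-1.
    by rewrite sqrrN E2 mulrN mulNr -mulrA E in h2; exact: aux h2 h1.
  by rewrite ler_pdivrMr in h3.
have [x xP] : exists l, forall e : R, 0 < e -> exists N, forall n, (N <= n)%N ->
    nm (u n - l) <= e.
  apply: nm_complete => e e0.
  have ce : 0 < c * e ^+ 2 / 4 by rewrite divr_gt0// mulr_gt0// exprn_gt0.
  have [N hN] := invr_small _ ce; exists N => m n /hN hm /hN hn.
  rewrite -(ler_pXn2r (n := 2)) ?nnegrE ?nm_ge0 ?(ltW e0)//.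
  apply: le_trans (ucauchy m n) _.
  rewrite mulrAC ler_pdivrMr// [leRHS]mulrC.
  have aux (a b z : R) : a <= z / 4 -> b <= z / 4 -> 2 * (a + b) <= z by lra.
  exact: aux hm hn.
exists x => v; apply/eqP; rewrite -subr_eq0 -normr_le0; apply/ler_addgt0Pr => e e0.
rewrite add0r; pose D := L * nm v + 1.
have D0 : 0 < D by rewrite ltr_wpDl// mulr_ge0 ?nm_ge0.
have e2 : 0 < e / 2 / D by rewrite !divr_gt0.
have e3 : 0 < (e / 2) ^+ 2 / (rip (S v) v + 1).
  rewrite divr_gt0// ?exprn_gt0 ?divr_gt0// ltr_wpDl// (le_trans _ (Sc v))//.
  by rewrite mulr_ge0 ?sqr_ge0 ?ltW.
have [N1 hN1] := xP _ e2; have [N2 hN2] := invr_small _ e3.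
pose n := maxn N1 N2.
(* By symmetry of S, the residual at the limit differs from that at [u n] by a product with
   [u n - x]. *)
have -> : rip (S x) v - F v = rip (u n - x) (- S v) + (rip (S (u n)) v - F v).
  by rewrite !ripE -!Ss; ring.
have h1 : `|rip (u n - x) (- S v)| <= e / 2.
  apply: le_trans (Re_le_cabs _) _; apply: le_trans (inner_le _ _) _.
  rewrite nmN; apply: le_trans (ler_pM (nm_ge0 _) (nm_ge0 _) (hN1 n _) (SL v)) _.
    exact: leq_maxl.
  by rewrite mulrAC ler_pdivrMr// ler_wpM2l ?divr_ge0 ?(ltW e0)// lerDl.
have h2 : `|rip (S (u n)) v - F v| <= e / 2.
  rewrite -(ler_pXn2r (n := 2)) ?nnegrE ?divr_ge0 ?(ltW e0)// real_normK ?num_real//.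
  apply: le_trans (eqn n v) _.
  have Sv : 0 <= rip (S v) v by rewrite (le_trans _ (Sc v))// mulr_ge0 ?sqr_ge0 ?ltW.
  have := hN2 n (leq_maxr _ _); rewrite ler_pdivlMr ?ltr_wpDl// => h.
  by apply: le_trans h; rewrite ler_wpM2l// ?invr_ge0// lerDl.
by rewrite (le_trans (ler_normD _ _))// (splitr e) lerD.
Qed.

End Complete.

(** * Adjoints and polynomials of operators *)

Section Operators.
Context {R : realType} {H : hilbertType R}.
Implicit Types (A B S T : bop H) (x y z : H) (a b : R[i]) (r s : R).

Lemma bopD A B x : (A + B) x = A x + B x. Proof. by []. Qed.
Lemma bopN A x : (- A) x = - A x. Proof. by []. Qed.
Lemma bopZ a A x : (a *: A) x = a *: A x. Proof. by []. Qed.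
Lemma bopM A B x : (A * B) x = A (B x). Proof. by []. Qed.
Lemma bop1 x : (1 : bop H) x = x. Proof. by []. Qed.
Lemma bop0 x : (0 : bop H) x = 0. Proof. by []. Qed.
Definition bopE := (bopD, bopN, bopZ, bopM, bop1, bop0).

Lemma bopZl a A B : (a *: A) * B = a *: (A * B).
Proof. exact: bopP. Qed.

Lemma bopZr a A B : A * (a *: B) = a *: (A * B).
Proof. by apply: bopP => x; rewrite !bopE linearZ. Qed.

Lemma inner_eq x y : (forall v, inner v x = inner v y) -> x = y.
Proof. by move=> xy; apply: rip_eq => v; rewrite !(ripC _ v) /rip xy. Qed.

(** Lax-Milgram for the identity is the Riesz theorem for the real functional Re <Tv,y>; complex
    linearity in v recovers the whole inner product. *)
Lemma adjoint_ex T : exists B : bop H, forall x y, inner (T x) y = inner x (B y).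
Proof.
have [L L0 TL] := bop_bound T.
have /choice[B BP] y : exists z, forall v, inner (T v) y = inner v z.
  have [||x|u v|r x|x|z zP] :=
    lax_milgram (1 : bop H) (fun v => rip (T v) y) 1 (L * nm y).
  - by [].
  - by [].
  - by rewrite mul1r ripxx.
  - by rewrite linearD ripE.
  - by rewrite linearZ ripE.
  - by rewrite mulrAC (le_trans (rip_le _ _))// ler_wpM2r ?nm_ge0.
  exists z; apply: linear_Re_eq => [a v|a v|v].
  - by rewrite linearZ innerZl.
  - by rewrite innerZl.
  - by have := zP v; rewrite bop1 ripC /rip => ->.
have Bl : linear B.
  move=> a x y; apply: inner_eq => v.
  by rewrite -BP innerDr innerZr innerDr innerZr -!BP.
have [x|C CB] := bop_ex B L Bl.
  have [->|x0] := eqVneq (nm (B x)) 0; first by rewrite mulr_ge0 ?nm_ge0.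
  have p0 : 0 < nm (B x) by rewrite lt_neqAle eq_sym x0 nm_ge0.
  (* Here |Bx|^2 = Re <T(Bx),x> <= L |Bx| |x|, and one factor |Bx| cancels. *)
  rewrite -(ler_pM2l p0) -expr2 -ripxx /rip -BP mulrCA mulrA.
  by rewrite (le_trans (rip_le _ _))// ler_wpM2r ?nm_ge0.
by exists C => x y; rewrite CB BP.
Qed.

Lemma adjointP T x y : inner (T x) y = inner x (adjoint T y).
Proof.
exact: (xgetPex 0 (P := [set B : bop H | _]) (adjoint_ex T)).
Qed.

Lemma adjointPV T x y : inner x (T y) = inner (adjoint T x) y.
Proof. by rewrite innerC adjointP -innerC. Qed.

Lemma adjointK T : adjoint (adjoint T) = T.
Proof.
by apply: bopP => y; apply: inner_eq => v; rewrite -adjointP -adjointPV.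
Qed.

Definition selfadjoint A := forall x y, inner (A x) y = inner x (A y).
Definition positive A := selfadjoint A /\ forall x, 0 <= rip (A x) x.

Lemma sa_rip A x y : selfadjoint A -> rip (A x) y = rip x (A y).
Proof. by move=> sA; rewrite /rip sA. Qed.

Lemma sa_real A x : selfadjoint A -> inner (A x) x = (rip (A x) x)%:C.
Proof.
move=> sA; have : inner (A x) x = Num.conj (inner (A x) x).
  by rewrite -innerC sA.
by rewrite /rip; case: (inner _ _) => u v [] /eqP; rewrite -addr_eq0 -mulr2n mulrn_eq0/= => /eqP ->.
Qed.

Lemma sa1 : selfadjoint 1.
Proof. by []. Qed.

Lemma saD A B : selfadjoint A -> selfadjoint B -> selfadjoint (A + B).
Proof. by move=> sA sB x y; rewrite !bopE innerDl innerDr sA sB. Qed.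

Lemma saZ r A : selfadjoint A -> selfadjoint (r%:C *: A).
Proof. by move=> sA x y; rewrite !bopE innerZl innerZr sA conj_real. Qed.

Lemma saX n A : selfadjoint A -> selfadjoint (A ^+ n).
Proof.
move=> sA; elim: n => [|n IH x y]; first by rewrite expr0; exact: sa1.
by rewrite exprS bopM sA IH -bopM -exprSr exprS.
Qed.

Lemma sa_poly p A : selfadjoint A -> selfadjoint (poly_op p A).
Proof.
move=> sA; rewrite /poly_op; elim/big_rec : _ => [x y|i B _ sB].
  by rewrite !bopE inner0l inner0r.
by apply: saD => //; apply/saZ/saX.
Qed.

Lemma positive_adjM T : positive (adjoint T * T).
Proof.
split=> [x y|x]; first by rewrite !bopE -adjointPV adjointP.
by rewrite bopE /rip -adjointPV -/(rip _ _) ripxx sqr_ge0.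
Qed.

(** Complex coefficients allow the factorisation of a real polynomial into linear factors. *)
Definition cpoly_op (q : {poly R[i]}) A : bop H := \sum_(i < size q) q`_i *: A ^+ i.

Lemma cpoly_opE n (q : {poly R[i]}) A : (size q <= n)%N -> cpoly_op q A = \sum_(i < n) q`_i *: A ^+ i.
Proof.
move=> qn; rewrite /cpoly_op (big_ord_widen _ (fun i => q`_i *: A ^+ i) qn).
rewrite [RHS](bigID (fun i : 'I_n => (i < size q)%N))/= [X in _ + X]big1 ?addr0//.
by move=> i; rewrite -leqNgt => qi; rewrite nth_default// scale0r.
Qed.

Lemma cpoly_opD (p q : {poly R[i]}) A : cpoly_op (p + q) A = cpoly_op p A + cpoly_op q A.
Proof.
pose n := maxn (size p) (size q).
rewrite (cpoly_opE n) ?size_polyD// (cpoly_opE n p) ?leq_maxl//.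
rewrite (cpoly_opE n q) ?leq_maxr// -big_split/=.
by apply: eq_bigr => i _; rewrite coefD scalerDl.
Qed.

Lemma cpoly_opZ a q A : cpoly_op (a *: q) A = a *: cpoly_op q A.
Proof.
rewrite (cpoly_opE (size q)) ?size_scale_leq// scaler_sumr.
by apply: eq_bigr => i _; rewrite coefZ scalerA.
Qed.

Lemma cpoly_opC a A : cpoly_op a%:P A = a *: (1 : bop H).
Proof. by rewrite (cpoly_opE 1) ?size_polyC_leq1// big_ord1 coefC eqxx expr0. Qed.

Lemma cpoly_opMX q A : cpoly_op (q * 'X) A = cpoly_op q A * A.
Proof.
rewrite (cpoly_opE (size q).+1); last first.
  by have [->|q0] := eqVneq q 0; rewrite ?mul0r ?size_poly0// size_mulX.
rewrite big_ord_recl coefMX scale0r add0r mulr_suml.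
by apply: eq_bigr => i _; rewrite coefMX/= bopZl -exprSr.
Qed.

Lemma cpoly_opM (p q : {poly R[i]}) A : cpoly_op (p * q) A = cpoly_op p A * cpoly_op q A.
Proof.
elim/poly_ind: p => [|p c IH].
  by rewrite -[0 in LHS](scale0r 1) -[0 in RHS](scale0r 1) -scalerAl !cpoly_opZ !scale0r mul0r.
have cX B : cpoly_op q A * A = A * cpoly_op q A.
  rewrite mulr_suml mulr_sumr; apply: eq_bigr => i _.
  by rewrite bopZl bopZr -exprSr -exprS.
rewrite mulrDl !cpoly_opD mulrDl mul_polyC cpoly_opZ cpoly_opC.
rewrite bopZl mul1r; congr (_ + _).
by rewrite mulrAC !cpoly_opMX IH -!mulrA cX.
Qed.

Lemma poly_opE p A : poly_op p A = cpoly_op (map_poly (real_complex R) p) A.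
Proof.
rewrite /poly_op /cpoly_op size_map_poly.
by apply: eq_bigr => i _; rewrite coef_map.
Qed.

Lemma poly_opD (p q : {poly R}) A : poly_op (p + q) A = poly_op p A + poly_op q A.
Proof. by rewrite !poly_opE rmorphD cpoly_opD. Qed.

Lemma poly_opZ r p A : poly_op (r *: p) A = r%:C *: poly_op p A.
Proof. by rewrite !poly_opE map_polyZ cpoly_opZ. Qed.

Lemma poly_opB (p q : {poly R}) A : poly_op (p - q) A = poly_op p A - poly_op q A.
Proof. by rewrite -scaleN1r poly_opD poly_opZ rmorphN scaleN1r. Qed.

Lemma poly_opC r A : poly_op r%:P A = r%:C *: (1 : bop H).
Proof. by rewrite !poly_opE map_polyC cpoly_opC. Qed.

Lemma poly_opM (p q : {poly R}) A : poly_op (p * q) A = poly_op p A * poly_op q A.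
Proof. by rewrite !poly_opE rmorphM cpoly_opM. Qed.

Lemma poly_opX A : poly_op 'X A = A.
Proof.
rewrite poly_opE map_polyX -[cpoly_op _ _]mul1r -[1 in LHS]scale1r.
by rewrite -(cpoly_opC 1 A) -cpoly_opM cpoly_opMX cpoly_opC scale1r mul1r.
Qed.

Lemma poly_op_intertwine p A B T : T * A = B * T -> T * poly_op p A = poly_op p B * T.
Proof.
move=> TA; elim/poly_ind: p => [|p c IH].
  by rewrite -(polyC0 _) !poly_opC scale0r mulr0 mul0r.
rewrite !poly_opD !poly_opM !poly_opC !poly_opX mulrDr mulrDl.
by rewrite mulrA IH -mulrA TA mulrA bopZl bopZr mul1r mulr1.
Qed.

End Operators.

(** * Polynomials are bounded by their values on the spectrum *)

Section SpectralBound.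
Context {R : realType} {H : hilbertType R}.
Implicit Types (A B S T : bop H) (x y z : H) (a b : R[i]) (r s : R).

(** This stands in for invertibility: it passes to products and already excludes approximate
    eigenvectors for 0. *)
Definition bounded_below A := exists2 d : R, 0 < d & forall x, d * nm x <= nm (A x).

Lemma resolvent_bounded_below A a :
  ~ spectrum A a -> bounded_below (A - a *: (1 : bop H)).
Proof.
move=> /contrapT[B [_ BA]]; have [L L0 BL] := bop_bound B.
have L1 : 0 < L + 1 by rewrite ltr_wpDl.
exists (L + 1)^-1; rewrite ?invr_gt0// => x; rewrite ler_pdivrMl//.
have {1}-> : x = B ((A - a *: (1 : bop H)) x) by rewrite -bopM BA bop1.
by rewrite (le_trans (BL _))// ler_wpM2r ?nm_ge0// lerDl.
Qed.

(** As <Ax,x> is real, <(A - a)x,x> has imaginary part - Im a |x|^2, and Cauchy-Schwarz bounds its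
    modulus by |(A - a)x| |x|. *)
Lemma nonreal_bounded_below A a : selfadjoint A -> complex.Im a != 0 ->
  bounded_below (A - a *: (1 : bop H)).
Proof.
move=> sA a0; exists `|complex.Im a| => [|x]; first by rewrite normr_gt0.
have [->|x0] := eqVneq (nm x) 0; first by rewrite mulr0 nm_ge0.
have p0 : 0 < nm x by rewrite lt_neqAle eq_sym x0 nm_ge0.
rewrite -(ler_pM2r p0) (le_trans _ (inner_le _ _))//.
set w := inner _ _; have wE : complex.Im w = - (complex.Im a * nm x ^+ 2).
  rewrite /w !bopE innerDl innerNl innerZl sa_real// innerE nmE -rmorphXn.
  by case: a {a0 w} => u v /=; rewrite mulr0 !add0r.
have nx := nm_ge0 x; rewrite -mulrA -expr2 -(ler_pXn2r (n := 2)) ?nnegrE ?cabs_ge0 ?mulr_ge0 ?sqr_ge0//.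
rewrite cabs_sq wE sqrrN !exprMn real_normK ?num_real// lerDr; exact: sqr_ge0.
Qed.

Lemma bounded_belowM A B : bounded_below A -> bounded_below B -> bounded_below (A * B).
Proof.
move=> [d d0 Ad] [e e0 Be]; exists (d * e) => [|x]; first exact: mulr_gt0.
by rewrite bopM -mulrA (le_trans _ (Ad _))// ler_wpM2l ?(ltW d0).
Qed.

Lemma bounded_belowZ a A : a != 0 -> bounded_below A -> bounded_below (a *: A).
Proof.
move=> a0 [d d0 Ad]; exists (cabs a * d) => [|x]; first by rewrite mulr_gt0 ?cabs_gt0.
by rewrite bopE nmZ -mulrA ler_wpM2l// cabs_ge0.
Qed.

Lemma roots_bounded_below (q : {poly R[i]}) A : q != 0 ->
    (forall a, root q a -> bounded_below (A - a *: (1 : bop H))) ->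
  bounded_below (cpoly_op q A).
Proof.
move=> q0 qA; have [rs qE] := closed_field_poly_normal q.
rewrite {}qE in q0 qA *; rewrite cpoly_opZ.
have lq : lead_coef q != 0.
  by apply: contra q0 => /eqP ->; rewrite scale0r.
apply: bounded_belowZ => //.
have {}qA a : a \in rs -> bounded_below (A - a *: (1 : bop H)).
  by move=> ars; apply: qA; rewrite rootZ// root_prod_XsubC.
elim: rs qA {q0 lq} => [_|a rs IH qA].
  rewrite big_nil -[1]/(1%:P) cpoly_opC; exists 1 => // x.
  by rewrite mul1r scale1r.
rewrite big_cons cpoly_opM; apply: bounded_belowM; last first.
  by apply: IH => b brs; apply: qA; rewrite in_cons brs orbT.
have -> : cpoly_op ('X - a%:P) A = A - a *: (1 : bop H).
  rewrite -polyCN cpoly_opD cpoly_opC scaleNr; congr (_ + _).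
  by have := poly_opX A; rewrite poly_opE map_polyX.
by apply: qA; rewrite in_cons eqxx.
Qed.

(* [|(B^2 - c^2) x|^2 <= c^2 (c^2 |x|^2 - |B x|^2)] is arbitrarily small on unit vectors. *)
Lemma sqr_sub_norm_gap B (c : R) : selfadjoint B -> opnorm B = c -> 0 < c ->
  ~ bounded_below (B * B - (c ^+ 2)%:C *: (1 : bop H)).
Proof.
move=> sB Bc c0 [d d0 Bd].
have c20 : 0 < c ^+ 2 by rewrite exprn_gt0.
(* A lower bound d for B^2 - c^2 would give |Bx|^2 <= e |x|^2 with e < c^2, against the choice of c
   as the norm of B. *)
pose e := c ^+ 2 - d ^+ 2 / c ^+ 2.
have key x : nm (B x) ^+ 2 <= nm x ^+ 2 * e.
  have := Bd x; rewrite -(ler_pXn2r (n := 2)) ?nnegrE ?mulr_ge0 ?nm_ge0 ?(ltW d0)//.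
  rewrite -[leRHS]ripxx !bopE !ripE.
  have E : rip (B (B x)) x = nm (B x) ^+ 2 by rewrite sa_rip// ripxx.
  rewrite (ripC x) E !ripxx.
  have : nm (B (B x)) ^+ 2 <= c ^+ 2 * nm (B x) ^+ 2.
    rewrite -exprMn ler_pXn2r ?nnegrE ?mulr_ge0 ?nm_ge0 ?(ltW c0)//.
    by rewrite -Bc opnormP.
  rewrite exprMn => h1 h2.
  have h3 : d ^+ 2 * nm x ^+ 2 <= c ^+ 2 * (c ^+ 2 * nm x ^+ 2 - nm (B x) ^+ 2) by nra.
  rewrite /e mulrBr lerBrDr mulrA -lerBrDl ler_pdivrMr// mulrC.
  by rewrite (le_trans h3)// mulrC (mulrC (c ^+ 2) (nm x ^+ 2)).
have : c <= Num.sqrt e.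
  rewrite -Bc; apply: opnorm_le; first exact: sqrtr_ge0.
  move=> x; rewrite -[nm (B x)]ger0_norm ?nm_ge0// -sqrtr_sqr.
  rewrite (le_trans (ler_wsqrtr (key x)))// sqrtrM ?sqr_ge0// sqrtr_sqr.
  by rewrite ger0_norm ?nm_ge0// mulrC.
have [e0|e0] := leP e 0; first by rewrite ler0_sqrtr// leNgt c0.
move=> /(lerXn2r 2); rewrite !nnegrE sqrtr_ge0 (ltW c0) => /(_ isT isT).
by rewrite sqr_sqrtr ?(ltW e0)// /e leNgt ltrBlDr ltrDl divr_gt0 ?exprn_gt0.
Qed.

(** With c the norm of p(A), assumed larger than r, a root of p^2 - c^2 is either nonreal or a real
    point with |p| = c > r, hence off the spectrum. The last hypothesis makes p^2 - c^2 nonzero, as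
    its factorisation requires. *)
Lemma poly_opnorm_le_aux A (p : {poly R}) r : selfadjoint A -> 0 <= r ->
    (forall s, spectrum A s%:C -> `|p.[s]| <= r) ->
    (forall c, p * p != (c ^+ 2)%:P) ->
  opnorm (poly_op p A) <= r.
Proof.
move=> sA r0 pr pc; rewrite leNgt; apply/negP => rc.
set c := opnorm _ in rc.
apply: (@sqr_sub_norm_gap (poly_op p A) c) => //; first exact: sa_poly.
  exact: le_lt_trans rc.
have -> : poly_op p A * poly_op p A - (c ^+ 2)%:C *: (1 : bop H) =
    cpoly_op (map_poly (real_complex R) (p * p - (c ^+ 2)%:P)) A.
  by rewrite -poly_opE poly_opB poly_opM poly_opC.
apply: roots_bounded_below; first by rewrite map_poly_eq0 subr_eq0.
move=> a; have [a0|a0] := eqVneq (complex.Im a) 0; last first.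
  by move=> _; exact: nonreal_bounded_below.
have -> : a = (complex.Re a)%:C by case: a a0 => u v /= ->.
rewrite fmorph_root rootE !hornerE subr_eq0 -expr2 eqf_sqr => pac.
apply: resolvent_bounded_below => /pr; apply/negP; rewrite -ltNge.
have c0 : 0 <= c by rewrite (le_trans r0)// ltW.
by case/orP: pac => /eqP ->; rewrite ?normrN ger0_norm.
Qed.

(** What is left is the case of p^2 equal to a constant c^2, where |p| = |c| everywhere and |p(A)x|
    = |c| |x|. *)
Lemma poly_opnorm_le A (p : {poly R}) r : selfadjoint A -> 0 <= r ->
    (forall s, spectrum A s%:C -> `|p.[s]| <= r) ->
  opnorm (poly_op p A) <= r.
Proof.
move=> sA r0 pr.
have [|pc] := pselect (forall c, p * p != (c ^+ 2)%:P).
  exact: poly_opnorm_le_aux.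
have [c /negP/negPn/eqP pcE] : exists c, ~ p * p != (c ^+ 2)%:P by apply/existsNP.
have pc1 s : `|p.[s]| = `|c|.
  apply/eqP; rewrite -(eqrXn2 (n := 2))// !real_normK ?num_real//.
  by rewrite expr2 -hornerM pcE hornerC.
have [c1|c1] := leP `|c| r.
  apply: opnorm_le => // x; apply: (@le_trans _ _ (`|c| * nm x)); last first.
    by rewrite ler_wpM2r ?nm_ge0.
  rewrite -(ler_pXn2r (n := 2)) ?nnegrE ?mulr_ge0 ?nm_ge0// exprMn.
  rewrite -!ripxx -sa_rip; last exact: sa_poly.
  by rewrite -bopM -poly_opM pcE poly_opC !bopE ripE real_normK ?num_real.
(* The spectrum is empty, which forces A = 0 and then H = 0. *)
have sp0 s : ~ spectrum A s%:C.
  by move=> /pr; rewrite pc1 leNgt c1.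
(* With no real spectral points, [poly_opnorm_le_aux] applies to 'X with the bound 0. Since 0 is not
   in the spectrum either, every x is A(Bx), hence 0. *)
have A0 : opnorm A <= 0.
  rewrite -(poly_opX A); apply: poly_opnorm_le_aux => // [s /sp0//|d].
  apply/eqP => /(congr1 (fun q : {poly R} => size q)).
  by rewrite size_mulX ?polyX_eq0// size_polyX size_polyC; case: eqP.
have [B [AB _]] := contrapT (sp0 0).
have H0 x : x = 0.
  rewrite -[x](bop1 (H := H)) -AB bopM scale0r subr0; apply/nm_eq0/eqP.
  rewrite eq_le nm_ge0 andbT (le_trans (opnormP _ _))//.
  by rewrite mulr_le0_ge0 ?nm_ge0.
by apply: opnorm_le => // x; rewrite (H0 (poly_op _ _ _)) nm0 mulr_ge0 ?nm_ge0.
Qed.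

End SpectralBound.

(** * Weierstrass approximation on the half-line *)

Section Weierstrass.
Context {R : realType}.
Implicit Types (f : R -> R) (u v : nat -> R) (x y a b c d e M : R).

Lemma nonneg_continuousP f : {within `[0, +oo[, continuous f} ->
  forall x e, 0 <= x -> 0 < e -> exists2 d, 0 < d &
    forall y, 0 <= y -> `|x - y| < d -> `|f x - f y| < e.
Proof.
move=> /subspace_continuousP cf x e x0 e0.
have /cf : `[0, +oo[%classic x by rewrite /= in_itv/= x0.
move=> /cvgrPdist_lt/(_ e e0); rewrite near_withinE => /nbhs_ballP[d /= d0 hd].
by exists d => // y y0 xy; apply: hd => //=; rewrite in_itv/= y0.
Qed.

(** Heine-Cantor by near-coverings: a d that works near each point of the compact segment works on
    all of it. Only x is confined to the segment. *)
Lemma nonneg_unif_continuous f M e : {within `[0, +oo[, continuous f} -> 0 < e ->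
  exists2 d, 0 < d & forall x y, 0 <= x <= M -> 0 <= y -> `|x - y| < d ->
    `|f x - f y| < e.
Proof.
move=> cf e0; have := @segment_compact R 0 M; rewrite compact_near_coveringP.
move=> /(_ _ (0 : R)^'+ (fun d x => 0 <= x -> forall y, 0 <= y -> `|x - y| < d ->
    `|f x - f y| < e)) [].
  move=> x /=; rewrite in_itv/= => /andP[x0 _].
  have e2 : 0 < e / 2 by rewrite divr_gt0.
  have [d d0 hd] := nonneg_continuousP _ cf x _ x0 e2.
  have d2 : 0 < d / 2 by rewrite divr_gt0.
  exists (ball x (d / 2), [set r | r < d / 2]).
    split=> /=; first exact: nbhsx_ballx.
    exact: nbhs_right_lt.
  move=> [x' r]/= [xx' rd] x'0 y y0 x'y.
  have h1 := hd _ x'0 (lt_trans xx' _); have h2 : `|x - y| < d.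
    rewrite -(subrK x' x) -addrA (le_lt_trans (ler_normD _ _))// (splitr d) ltrD//.
    exact: lt_trans rd.
  rewrite -(subrK (f x) (f x')) -addrA (le_lt_trans (ler_normD _ _))// (splitr e) ltrD//.
    by rewrite distrC h1// ltr_pdivrMr// ltr_pMr// ltr1n.
  exact: hd.
move=> d0 /= d0p hd; exists (d0 / 2) => [|x y]; first by rewrite divr_gt0.
move=> xM y0 xy; have x0 : 0 <= x by case/andP: xM.
apply: (hd (d0 / 2)) => //=.
- by rewrite /ball/= sub0r normrN gtr0_norm ?divr_gt0// ltr_pdivrMr// ltr_pMr// ltr1n.
- by rewrite divr_gt0.
Qed.

Lemma nonneg_bounded f M : {within `[0, +oo[, continuous f} -> 0 <= M ->
  exists2 C, 0 <= C & forall x, 0 <= x <= M -> `|f x| <= C.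
Proof.
move=> cf M0; have cf' : {within `[0, M], continuous f}.
  apply: continuous_subspaceW cf => x /=; rewrite !in_itv/= => /andP[-> //].
have [u uM fu] := EVT_max M0 cf'; have [v vM fv] := EVT_min M0 cf'.
exists (`|f u| + `|f v|) => [|x xM]; first exact: addr_ge0.
have {}xM : x \in `[0, M] by rewrite in_itv.
rewrite ler_norml; apply/andP; split.
  rewrite lerNl (le_trans (_ : _ <= - f v)) ?lerN2 ?fv//.
  by rewrite (le_trans (ler_norm _))// normrN lerDr.
by rewrite (le_trans (fu _ xM))// (le_trans (ler_norm _))// lerDl.
Qed.

(* The Bernstein polynomial of degree n with values u 0, ..., u n, in the form of
   de Casteljau's recursion. *)
Fixpoint bernstein n u : {poly R} :=
  if n is n'.+1 then
    (1 - 'X) * bernstein n' u + 'X * bernstein n' (fun k => u k.+1)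
  else (u 0)%:P.

(** Each step of the recursion averages with the weights 1 - x and x, which are nonnegative on
    [0, 1]. *)
Lemma le_bernstein n u v x : 0 <= x <= 1 -> (forall k, (k <= n)%N -> u k <= v k) ->
  (bernstein n u).[x] <= (bernstein n v).[x].
Proof.
move=> /andP[x0 x1]; elim: n u v => [|n IH] u v uv /=.
  by rewrite !hornerC uv.
rewrite !hornerE lerD// ler_wpM2l ?subr_ge0//; apply: IH => k kn.
  exact/uv/leqW.
exact: uv.
Qed.

(** These are the first two moments of the binomial distribution. The shift k to k + 1 preserves
    quadratics, so the induction runs over all a, b and c. *)
Lemma bernstein_quadratic n a b c x :
  (bernstein n (fun k => a + b * k%:R + c * k%:R ^+ 2)).[x] =
    a + b * (n%:R * x) + c * (n%:R * (x * (1 - x)) + (n%:R * x) ^+ 2).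
Proof.
elim: n a b c => [|n IH] a b c /=.
  by rewrite hornerC; ring.
have -> : (fun k => a + b * k.+1%:R + c * k.+1%:R ^+ 2) =
    (fun k => (a + b + c) + (b + 2 * c) * k%:R + c * k%:R ^+ 2).
  by apply/funext => k; rewrite -natr1; ring.
rewrite hornerD !hornerM.
have -> : (1 - 'X : {poly R}).[x] = 1 - x by rewrite !hornerE.
by rewrite !IH hornerX -natr1; ring.
Qed.

(** For close points uniform continuity gives e; for points at distance at least d the quadratic
    term exceeds 2 C, with C a bound for |f|. *)
Lemma quadratic_modulus f M e : {within `[0, +oo[, continuous f} -> 0 <= M -> 0 < e ->
  exists2 K, 0 <= K & forall x y, 0 <= x <= M -> 0 <= y <= M ->
    `|f x - f y| <= e + K * (x - y) ^+ 2.
Proof.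
move=> cf M0 e0; have [C C0 fC] := nonneg_bounded _ _ cf M0.
have [d d0 fd] := nonneg_unif_continuous _ M _ cf e0.
exists (2 * C / d ^+ 2) => [|x y xM yM].
  by rewrite divr_ge0 ?sqr_ge0// mulr_ge0.
have [xyd|xyd] := ltP `|x - y| d.
  rewrite (le_trans (ltW (fd _ _ xM _ xyd)))//; first by case/andP: yM.
  by rewrite lerDl mulr_ge0 ?sqr_ge0// divr_ge0 ?sqr_ge0// mulr_ge0.
have h : d ^+ 2 <= (x - y) ^+ 2.
  by rewrite -[leRHS]real_normK ?num_real// ler_pXn2r ?nnegrE// ltW.
rewrite (@le_trans _ _ (2 * C))//.
  rewrite (le_trans (ler_normB _ _))// mulrDl mul1r lerD ?fC//.
rewrite -[leLHS]add0r lerD ?(ltW e0)// mulrAC ler_pdivlMr ?exprn_gt0//.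
by rewrite ler_wpM2l// mulr_ge0.
Qed.

(** The sampled values of f lie between two quadratics in k. The Bernstein operator is monotone and
    explicit on quadratics, so its error is at most e / 2 plus a variance term of order 1/n. *)
Theorem weierstrass f M e : {within `[0, +oo[, continuous f} -> 0 < M -> 0 < e ->
  exists p : {poly R}, forall x, 0 <= x <= M -> `|p.[x] - f x| <= e.
Proof.
move=> cf M0 e0; have e2 : 0 < e / 2 by rewrite divr_gt0.
have [K K0 fK] := quadratic_modulus _ _ _ cf (ltW M0) e2.
have [n n0 nK] : exists2 n, 0 < n%:R :> R & K * M ^+ 2 / n%:R <= e / 2.
  exists (Num.truncn (K * M ^+ 2 / (e / 2))).+1; first by rewrite ltr0n.
  by rewrite ler_pdivrMr// [leRHS]mulrC -ler_pdivrMr// ltW// truncnS_gt.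
pose u k := f (M * (k%:R / n%:R)).
exists (bernstein n u \Po (M^-1 *: 'X)) => s /andP[s0 sM].
rewrite horner_comp !hornerE; set x := M^-1 * s.
have x0 : 0 <= x by rewrite mulr_ge0// invr_ge0 ltW.
have x1 : x <= 1 by rewrite ler_pdivrMl// mulr1.
have sE : s = M * x by rewrite mulrA mulfV ?mul1r// gt_eqF.
(* This is a + L (k/n - x)^2, expanded in powers of k to fit [bernstein_quadratic]. *)
pose q a L (k : nat) : R := (a + L * x ^+ 2) + (- (2 * L * x / n%:R)) * k%:R
  + L / n%:R ^+ 2 * k%:R ^+ 2.
have qE a L k : q a L k = a + L * (k%:R / n%:R - x) ^+ 2.
  by rewrite /q; field; rewrite gt_eqF.
have Bq a L : (bernstein n (q a L)).[x] = a + L * (x * (1 - x)) / n%:R.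
  by rewrite bernstein_quadratic; field; rewrite gt_eqF.
have uq k : (k <= n)%N -> `|u k - f s| <= e / 2 + K * M ^+ 2 * (k%:R / n%:R - x) ^+ 2.
  move=> kn; rewrite sE -mulrA -exprMn mulrBr; apply: fK; last by rewrite -sE s0.
  rewrite mulr_ge0 ?divr_ge0 ?(ltW M0)//= ler_piMr ?(ltW M0)//.
  by rewrite ler_pdivrMr// mul1r ler_nat.
have hx : 0 <= x * (1 - x) <= 1 by rewrite mulr_ge0 ?subr_ge0//= mulr_ile1 ?subr_ge0// gerBl.
have hK : K * M ^+ 2 * (x * (1 - x)) / n%:R <= e / 2.
  rewrite (le_trans _ nK)// ler_pM2r ?invr_gt0// ler_piMr//.
    by rewrite mulr_ge0 ?sqr_ge0.
  by case/andP: hx.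
have x01 : 0 <= x <= 1 by rewrite x0.
have up : (bernstein n u).[x] <= (bernstein n (q (f s + e / 2) (K * M ^+ 2))).[x].
  apply: le_bernstein => // k /uq; rewrite qE ler_norml => /andP[_].
  by rewrite lerBlDl addrA.
have lo : (bernstein n (q (f s - e / 2) (- (K * M ^+ 2)))).[x] <= (bernstein n u).[x].
  apply: le_bernstein => // k /uq; rewrite qE ler_norml => /andP[+ _].
  by rewrite lerBrDl opprD addrA mulNr.
rewrite !Bq !mulNr in up lo.
by move: up lo hK; move: (bernstein _ _).[_] (_ / n%:R) => B z *; rewrite ler_norml; lra.
Qed.

End Weierstrass.

(** * Existence and continuity of the functional calculus *)

Lemma le_eps (R : realType) (a b c : R) :
  (forall e, 0 < e -> a <= b + e * c) -> a <= b.
Proof.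
move=> h; apply/ler_addgt0Pr => e e0.
have c0 : 0 < `|c| + 1 by rewrite ltr_wpDl.
rewrite (le_trans (h (e / (`|c| + 1)) _)) ?divr_gt0// lerD2l mulrAC ler_pdivrMr//.
by rewrite ler_wpM2l ?(ltW e0)// (le_trans (ler_norm _))// lerDl.
Qed.

Lemma le_invn (R : realType) (a b c : R) : 0 <= c ->
  (forall n, a <= b + n.+1%:R^-1 * c) -> a <= b.
Proof.
move=> c0 h; apply: (le_eps _ _ _ c) => e e0; have [N hN] := invr_small e e0.
by rewrite (le_trans (h N))// lerD2l ler_wpM2r// hN.
Qed.

Lemma uniform_cvgP (R : realType) (S : set R) (F : nat -> R -> R) (f : R -> R) :
  {uniform S, F @ \oo --> f} <->
  (forall e, 0 < e -> exists N, forall n, (N <= n)%N -> forall s, S s -> `|F n s - f s| <= e).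
Proof.
split=> [Ff e e0|Ff P].
  have [|N _ hN] := Ff [set g : {uniform` S -> R} | forall s, S s -> `|g s - f s| <= e].
    apply/uniform_nbhs; exists [set xy | ball xy.1 e xy.2].
    split; first exact: (entourage_ball _ (PosNum e0)).
    by move=> g /= gS s /gS; rewrite distrC => /ltW.
  by exists N => n /hN.
move=> /uniform_nbhs[E [entE EP]].
have [e /= e0 eE] : exists2 e : R, 0 < e & [set xy | ball xy.1 e xy.2] `<=` E.
  by have [e e0 eE] := entE; exists e.
have e2 : 0 < e / 2 by rewrite divr_gt0.
have [N hN] := Ff _ e2; exists N => // n /= Nn; apply: EP => s Ss; apply: eE => /=.
by rewrite /ball/= distrC (le_lt_trans (hN n Nn s Ss))// ltr_pdivrMr// ltr_pMr// ltr1n.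
Qed.

Section Calculus.
Context {R : realType} {H : hilbertType R}.
Implicit Types (A B S T : bop H) (x y z : H) (r s c e : R) (f : R -> R).

(** Coercivity gives injectivity and the bound 1/c on the inverse; Lax-Milgram gives
    surjectivity. *)
Lemma coercive_invertible S c : selfadjoint S -> 0 < c ->
    (forall x, c * nm x ^+ 2 <= rip (S x) x) ->
  exists B : bop H, S * B = 1 /\ B * S = 1.
Proof.
move=> sS c0 Sc.
have Sinj x y : S x = S y -> x = y.
  move=> Sxy; apply/eqP; rewrite -subr_eq0; apply/eqP/nm_eq0/eqP.
  have S0 : S (x - y) = 0 by rewrite linearB; apply/eqP; rewrite subr_eq0; apply/eqP; exact: Sxy.
  have := Sc (x - y); rewrite S0 rip0l pmulr_rle0// => h.
  by rewrite -sqrf_eq0 eq_le h sqr_ge0.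
have /choice[B BP] y : exists x, S x = y.
  have [||x|u v|r x|x|x xP] := lax_milgram S (fun v => rip y v) c (nm y).
  - by move=> u v; exact: sa_rip.
  - by [].
  - exact: Sc.
  - by rewrite ripE.
  - by rewrite ripE.
  - exact: rip_le.
  by exists x; apply: rip_eq.
have Bl : linear B.
  move=> a x y; apply: Sinj.
  have -> : S (a *: B x + B y) = a *: S (B x) + S (B y) by rewrite linearP.
  by rewrite !BP.
have [x|C CB] := bop_ex B c^-1 Bl.
  rewrite ler_pdivlMl//; have [->|x0] := eqVneq (nm (B x)) 0; first by rewrite mulr0 nm_ge0.
  have p0 : 0 < nm (B x) by rewrite lt_neqAle eq_sym x0 nm_ge0.
  rewrite -(ler_pM2r p0) -mulrA -expr2 (le_trans (Sc _))// BP; exact: rip_le.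
exists C; split; apply: bopP => x; rewrite !bopE ?CB ?BP//.
by apply: Sinj; rewrite BP.
Qed.

(** For s < 0 the operator A - s is coercive with constant - s; for s above the norm, s - A is
    coercive with constant [s - opnorm A]. *)
Lemma positive_spectrum A s : positive A -> spectrum A s%:C -> 0 <= s <= opnorm A.
Proof.
move=> [sA pA] As; apply/andP; split; rewrite leNgt; apply/negP => hs; apply: As.
  apply: (coercive_invertible _ (- s)); rewrite ?oppr_gt0//.
    by rewrite -scaleNr -rmorphN; apply: saD => //; apply: saZ; apply: sa1.
  by move=> x; rewrite !bopE !ripE ripxx mulNr lerDr pA.
have [||x|B [SB BS]] := coercive_invertible (s%:C *: (1 : bop H) - A) (s - opnorm A).
- apply: saD; first exact: saZ.
  by move=> x y; rewrite !bopE innerNl innerNr sA.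
- by rewrite subr_gt0.
- rewrite !bopE !ripE ripxx mulrBl lerD2l lerN2 (le_trans (rip_le _ _))//.
  by rewrite expr2 mulrA ler_wpM2r ?nm_ge0// opnormP.
by exists (- B); rewrite mulrN mulNr -mulNr -mulrN !opprB.
Qed.

Lemma poly_op_le A (p : {poly R}) M r : positive A -> opnorm A <= M -> 0 <= r ->
    (forall s, 0 <= s <= M -> `|p.[s]| <= r) ->
  forall x, nm (poly_op p A x) <= r * nm x.
Proof.
move=> pA AM r0 pr x; rewrite (le_trans (opnormP _ _))// ler_wpM2r ?nm_ge0//.
apply: poly_opnorm_le => //; first by case: pA.
move=> s /(positive_spectrum _ _ pA)/andP[s0 sA]; apply: pr; rewrite s0/=.
exact: le_trans AM.
Qed.

(** The limit is taken pointwise, and letting one index tend to infinity in the Cauchy estimate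
    keeps an explicit rate. *)
Lemma bop_complete (u : nat -> bop H) :
    (forall m n x, nm (u m x - u n x) <= (m.+1%:R^-1 + n.+1%:R^-1) * nm x) ->
  exists B : bop H, forall n x, nm (u n x - B x) <= n.+1%:R^-1 * nm x.
Proof.
move=> uC.
have /choice[B BP] x : exists l, forall n, nm (u n x - l) <= n.+1%:R^-1 * nm x.
  have [e e0|l lP] := nm_complete (fun n => u n x).
    have e2 : 0 < e / 2 / (nm x + 1) by rewrite !divr_gt0// ltr_wpDl ?nm_ge0.
    have [N hN] := invr_small _ e2; exists N => m n /hN hm /hN hn.
    rewrite (le_trans (uC m n x))// (le_trans (ler_wpM2r (nm_ge0 x) (lerD hm hn)))//.
    rewrite -mulrDl -splitr mulrAC ler_pdivrMr ?ltr_wpDl ?nm_ge0//.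
    by rewrite ler_wpM2l ?(ltW e0)// lerDl.
  exists l => n; apply: (le_eps _ _ _ (nm x + 1)) => e e0.
  have [N1 h1] := lP _ e0; have [N2 h2] := invr_small _ e0.
  pose m := maxn N1 N2.
  rewrite -(subrK (u m x) (u n x)) -addrA (le_trans (nmD _ _))//.
  rewrite mulrDr mulr1 addrA lerD ?h1 ?leq_maxl// (le_trans (uC n m x))//.
  by rewrite mulrDl lerD2l ler_wpM2r ?nm_ge0 ?h2 ?leq_maxr.
have Bl : linear B.
  move=> a x y; apply/eqP; rewrite -subr_eq0; apply/eqP/nm_eq0/eqP.
  rewrite eq_le nm_ge0 andbT.
  apply: (le_invn _ _ _ (nm (a *: x + y) + (cabs a * nm x + nm y))) => [|n].
    by rewrite !addr_ge0 ?mulr_ge0 ?nm_ge0 ?cabs_ge0.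
  have -> : B (a *: x + y) - (a *: B x + B y) = (B (a *: x + y) - u n (a *: x + y))
      + (a *: (u n x - B x) + (u n y - B y)).
    rewrite [u n _]linearP scalerBr [X in _ = _ + X]addrACA -opprD.
    by rewrite addrA subrK.
  rewrite add0r !mulrDr (le_trans (nmD _ _))// lerD//; first by rewrite nmBC BP.
  rewrite (le_trans (nmD _ _))// lerD ?BP// nmZ mulrCA.
  by rewrite ler_wpM2l ?cabs_ge0// BP.
have [x|C CB] := bop_ex B (opnorm (u 0) + 1) Bl.
  rewrite -(subrK (u 0%N x) (B x)) addrC mulrDl mul1r (le_trans (nmD _ _))//.
  rewrite lerD ?opnormP// nmBC; have := BP x 0%N.
  by rewrite invr1 mul1r.
by exists C => n x; rewrite CB.
Qed.

(** Weierstrass polynomials on an interval containing the spectrum have Cauchy values at A, by the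
    spectral bound; their limit is the required operator. *)
Lemma cfcP A f : positive A -> {within `[0, +oo[, continuous f} -> is_cfc f A (cfc f A).
Proof.
move=> pA cf; apply: (xgetPex 0).
pose M := opnorm A + 1.
have M0 : 0 < M by rewrite ltr_wpDl ?opnorm_ge0.
have AM : opnorm A <= M by rewrite lerDl.
have /choice[p pP] n : exists p : {poly R}, forall s, 0 <= s <= M ->
    `|p.[s] - f s| <= n.+1%:R^-1.
  by apply: weierstrass => //; rewrite invr_gt0.
have [m n x|B BP] := bop_complete (fun n => poly_op (p n) A).
  have -> : poly_op (p m) A x - poly_op (p n) A x = poly_op (p m - p n) A x.
    by rewrite poly_opB.
  have r0 : 0 <= m.+1%:R^-1 + n.+1%:R^-1 :> R by rewrite addr_ge0 ?invr_ge0.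
  apply: (poly_op_le _ _ M _ pA AM r0) => s sM.
  rewrite !hornerE -(subrKA (f s)) (le_trans (ler_normD _ _))// lerD ?pP//.
  by rewrite distrC pP.
exists B, p; split.
  apply/uniform_cvgP => e e0; have [N hN] := invr_small _ e0.
  exists N => n /hN hn s /(positive_spectrum _ _ pA)/andP[s0 sA].
  by rewrite (le_trans _ hn)// pP// s0 (le_trans sA).
apply/cvgrPdist_le => e e0; have [N hN] := invr_small _ e0.
exists N => // n /= /hN hn; rewrite sub0r normrN ger0_norm ?opnorm_ge0//.
rewrite (le_trans _ hn)//; apply: opnorm_le => [|x]; first by rewrite invr_ge0.
exact: BP.
Qed.

(** Any polynomial close to f estimates f(A), by comparison with a late term of the sequence in
    [is_cfc]. *)
Lemma cfc_close A f (p : {poly R}) M r :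
    positive A -> {within `[0, +oo[, continuous f} -> opnorm A <= M -> 0 <= r ->
    (forall s, 0 <= s <= M -> `|p.[s] - f s| <= r) ->
  forall x, nm (poly_op p A x - cfc f A x) <= r * nm x.
Proof.
move=> pA cf AM r0 pr x; have [q [/uniform_cvgP qf /cvgrPdist_le qA]] := cfcP _ _ pA cf.
apply: (le_eps _ _ _ (nm x + nm x)) => e e0.
have [N1 h1] := qf _ e0; have [N2 _ h2] := qA _ e0.
pose n := maxn N1 N2.
have {}h1 := h1 n (leq_maxl _ _); have {}h2 := h2 n (leq_maxr _ _).
rewrite -(subrK (poly_op (q n) A x) (poly_op p A x)) -addrA (le_trans (nmD _ _))//.
rewrite mulrDr addrA -mulrDl lerD//.
  have -> : poly_op p A x - poly_op (q n) A x = poly_op (p - q n) A x.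
    by rewrite poly_opB.
  rewrite (le_trans (opnormP _ _))// ler_wpM2r ?nm_ge0//.
  apply: poly_opnorm_le => [||s As]; [by case: pA|by rewrite addr_ge0 ?(ltW e0)|].
  rewrite !hornerE -(subrKA (f s)) (le_trans (ler_normD _ _))// lerD//.
    by have /andP[s0 sA] := positive_spectrum _ _ pA As; rewrite pr// s0 (le_trans sA).
  by rewrite distrC h1.
rewrite (le_trans (opnormP (poly_op (q n) A - cfc f A) x))// ler_wpM2r ?nm_ge0//.
by move: h2; rewrite sub0r normrN ger0_norm ?opnorm_ge0.
Qed.

End Calculus.

(** * Algebra of the functional calculus *)

Section CalculusAlgebra.
Context {R : realType} {H : hilbertType R}.
Implicit Types (A B S T : bop H) (x y z : H) (r s c e : R) (f g : R -> R).
Implicit Types (p q : {poly R}).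

Lemma nonneg_continuousM f g : {within `[0, +oo[, continuous f} ->
  {within `[0, +oo[, continuous g} -> {within `[0, +oo[, continuous (fun s => f s * g s)}.
Proof. by move=> cf cg x; exact: cvgM (cf x) (cg x). Qed.

Lemma nonneg_continuousB f g : {within `[0, +oo[, continuous f} ->
  {within `[0, +oo[, continuous g} -> {within `[0, +oo[, continuous (fun s => f s - g s)}.
Proof. by move=> cf cg x; exact: cvgB (cf x) (cg x). Qed.

Lemma nonneg_continuous_horner p : {within `[0, +oo[, continuous (horner p)}.
Proof. by apply: continuous_subspaceT => x; exact: continuous_horner. Qed.

Lemma nonneg_continuous_sqrt : {within `[0, +oo[, continuous (@Num.sqrt R)}.
Proof. by apply: continuous_subspaceT => x; exact: sqrt_continuous. Qed.

Lemma nonneg_continuousV e : 0 < e -> {within `[0, +oo[, continuous (fun s => (s + e)^-1)}.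
Proof.
move=> e0; apply/subspace_continuousP => x /=; rewrite in_itv/= andbT => x0.
apply: cvg_within_filter; apply: cvgV; first by rewrite gt_eqF// ltr_wpDl.
by apply: cvgD; [exact: cvg_id|exact: cvg_cst].
Qed.

Lemma cfc_approx A f M e : positive A -> {within `[0, +oo[, continuous f} ->
    0 < M -> opnorm A <= M -> 0 < e ->
  exists p, (forall s, 0 <= s <= M -> `|p.[s] - f s| <= e) /\
    forall x, nm (poly_op p A x - cfc f A x) <= e * nm x.
Proof.
move=> pA cf M0 AM e0; have [p pf] := weierstrass f M e cf M0 e0.
exists p; split=> //; exact: cfc_close pA cf AM (ltW e0) pf.
Qed.

(** The constant C and the restriction e <= 1 leave room for the errors of products, which involve
    bounds on the factors. *)
Lemma cfc_unique A B f M C : positive A -> {within `[0, +oo[, continuous f} ->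
    opnorm A <= M -> 0 <= C ->
    (forall e, 0 < e -> e <= 1 -> exists p,
      (forall s, 0 <= s <= M -> `|p.[s] - f s| <= e * C) /\
      forall x, nm (poly_op p A x - B x) <= e * C * nm x) ->
  cfc f A = B.
Proof.
move=> pA cf AM C0 h; apply: bopP => x; apply/eqP; rewrite -subr_eq0; apply/eqP.
apply/nm_eq0/eqP; rewrite eq_le nm_ge0 andbT.
apply: (le_invn _ _ _ (2 * C * nm x)) => [|n]; first by rewrite !mulr_ge0 ?nm_ge0.
have n0 : 0 < n.+1%:R^-1 :> R by rewrite invr_gt0.
have n1 : n.+1%:R^-1 <= 1 :> R by rewrite invf_le1// ler1n.
have [p [pf pB]] := h _ n0 n1.
have pC := cfc_close _ _ _ _ _ pA cf AM (mulr_ge0 (ltW n0) C0) pf.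
rewrite -(subrKA (poly_op p A x)) add0r (le_trans (nmD _ _))// nmBC.
rewrite (le_trans (lerD (pC x) (pB x)))//.
by rewrite -mulrDl -mulrDr -mulr2n -[C *+ 2]mulr_natl -!mulrA.
Qed.

Lemma cfc_poly A f p : positive A -> {within `[0, +oo[, continuous f} ->
  (forall s, 0 <= s -> f s = p.[s]) -> cfc f A = poly_op p A.
Proof.
move=> pA cf fp; apply: (cfc_unique _ _ _ _ 0 pA cf (lexx _)) => // e e0 e1.
exists p; split=> [s /andP[s0 _]|x]; first by rewrite fp// subrr normr0 mulr0.
by rewrite subrr nm0 mulr0 mul0r.
Qed.

Lemma cfcB A f g : positive A ->
    {within `[0, +oo[, continuous f} -> {within `[0, +oo[, continuous g} ->
  cfc (fun s => f s - g s) A = cfc f A - cfc g A.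
Proof.
move=> pA cf cg; have cfg := nonneg_continuousB _ _ cf cg.
have M0 : 0 < opnorm A + 1 by rewrite ltr_wpDl ?opnorm_ge0.
have AM : opnorm A <= opnorm A + 1 by rewrite lerDl.
apply: (cfc_unique _ _ _ _ 2 pA cfg AM) => // e e0 e1.
have [p [pf pF]] := cfc_approx _ _ _ _ pA cf M0 AM e0.
have [q [qg qG]] := cfc_approx _ _ _ _ pA cg M0 AM e0.
exists (p - q); split=> [s sM|x].
  have -> : (p - q).[s] - (f s - g s) = (p.[s] - f s) - (q.[s] - g s).
    by rewrite !hornerE; ring.
  rewrite (le_trans (ler_normB _ _))// mulrDr mulr1; exact: lerD (pf _ sM) (qg _ sM).
have -> : poly_op (p - q) A x - (cfc f A - cfc g A) x =
    (poly_op p A x - cfc f A x) - (poly_op q A x - cfc g A x).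
  rewrite poly_opB !bopE !opprB addrACA [in RHS]addrACA; congr (_ + _).
  by rewrite addrC.
rewrite (le_trans (nmD _ _))// nmN mulrDr mulr1 mulrDl; exact: lerD (pF x) (qG x).
Qed.

Lemma cfcM A f g : positive A ->
    {within `[0, +oo[, continuous f} -> {within `[0, +oo[, continuous g} ->
  cfc (fun s => f s * g s) A = cfc f A * cfc g A.
Proof.
move=> pA cf cg; have cfg := nonneg_continuousM _ _ cf cg.
have M0 : 0 < opnorm A + 1 by rewrite ltr_wpDl ?opnorm_ge0.
have AM : opnorm A <= opnorm A + 1 by rewrite lerDl.
have [Cf Cf0 fC] := nonneg_bounded f _ cf (ltW M0).
have [Cg Cg0 gC] := nonneg_bounded g _ cg (ltW M0).
set F := cfc f A; set G := cfc g A.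
(* The error of a product is (p - f) q + f (q - g), for scalars and for operators; as e <= 1, q
   exceeds the bound for g by at most 1. *)
pose C := Cf + (Cg + 1) + (opnorm F + (opnorm G + 1)).
have C0 : 0 <= C by rewrite !addr_ge0 ?opnorm_ge0.
apply: (cfc_unique _ _ _ _ C pA cfg AM) => // e e0 e1.
have [p [pf pF]] := cfc_approx _ _ _ _ pA cf M0 AM e0.
have [q [qg qG]] := cfc_approx _ _ _ _ pA cg M0 AM e0.
exists (p * q); split=> [s sM|x].
  have -> : (p * q).[s] - f s * g s = (p.[s] - f s) * q.[s] + f s * (q.[s] - g s).
    by rewrite hornerM; ring.
  have hq : `|q.[s]| <= Cg + 1.
    rewrite -(subrK (g s) q.[s]) addrC (le_trans (ler_normD _ _))// lerD ?gC//.
    exact: le_trans (qg _ sM) e1.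
  rewrite (le_trans (ler_normD _ _))// !normrM.
  apply: (@le_trans _ _ (e * (Cg + 1) + Cf * e)).
    by rewrite lerD// ler_pM ?pf ?qg ?fC.
  rewrite [Cf * e]mulrC -mulrDr ler_wpM2l ?(ltW e0)//.
  by rewrite [Cg + 1 + Cf]addrC lerDl !addr_ge0 ?opnorm_ge0.
have -> : poly_op (p * q) A x - (F * G) x =
    (poly_op p A (poly_op q A x) - F (poly_op q A x)) + F (poly_op q A x - G x).
  have -> : F (poly_op q A x - G x) = F (poly_op q A x) - F (G x) by rewrite linearB.
  by rewrite addrA subrK poly_opM !bopM.
have hq : nm (poly_op q A x) <= (opnorm G + 1) * nm x.
  rewrite -(subrK (G x) (poly_op q A x)) addrC mulrDl mul1r (le_trans (nmD _ _))//.
  rewrite lerD ?opnormP// (le_trans (qG x))// ler_piMl ?nm_ge0//.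
rewrite (le_trans (nmD _ _))//.
apply: (@le_trans _ _ (e * ((opnorm G + 1) * nm x) + opnorm F * (e * nm x))).
  rewrite lerD//; first by rewrite (le_trans (pF _))// ler_wpM2l ?(ltW e0).
  by rewrite (le_trans (opnormP _ _))// ler_wpM2l ?opnorm_ge0.
rewrite [leLHS](_ : _ = e * (opnorm F + (opnorm G + 1)) * nm x); last by ring.
by rewrite ler_wpM2r ?nm_ge0// ler_wpM2l ?(ltW e0)// lerDr !addr_ge0.
Qed.

Lemma cfc_le A f M r : positive A -> {within `[0, +oo[, continuous f} ->
    0 < M -> opnorm A <= M -> 0 <= r -> (forall s, 0 <= s <= M -> `|f s| <= r) ->
  forall x, nm (cfc f A x) <= r * nm x.
Proof.
move=> pA cf M0 AM r0 fr x; apply: (le_eps _ _ _ (nm x + nm x)) => e e0.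
have [p [pf pF]] := cfc_approx _ _ _ _ pA cf M0 AM e0.
rewrite -(subrK (poly_op p A x) (cfc f A x)) addrC (le_trans (nmD _ _))//.
rewrite mulrDr addrA -mulrDl nmBC lerD//.
apply: (poly_op_le _ _ _ _ pA AM) => [|s sM]; first by rewrite addr_ge0 ?(ltW e0).
rewrite -(subrK (f s) p.[s]) addrC (le_trans (ler_normD _ _))// lerD ?fr//.
exact: pf.
Qed.

Lemma cfc_sa A f : positive A -> {within `[0, +oo[, continuous f} ->
  selfadjoint (cfc f A).
Proof.
move=> pA cf x y; set F := cfc f A.
apply/eqP; rewrite -subr_eq0 -normr_eq0 cabsE; apply/eqP; congr (_%:C); apply/eqP.
rewrite eq_le cabs_ge0 andbT.
have M0 : 0 < opnorm A + 1 by rewrite ltr_wpDl ?opnorm_ge0.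
have AM : opnorm A <= opnorm A + 1 by rewrite lerDl.
apply: (le_eps _ _ _ (nm x * nm y + nm x * nm y)) => e e0.
have [p [_ pF]] := cfc_approx _ _ _ _ pA cf M0 AM e0.
have -> : inner (F x) y - inner x (F y) =
    inner (F x - poly_op p A x) y + inner x (poly_op p A y - F y).
  rewrite innerDl innerDr innerNl innerNr -[inner x (poly_op p A y)]sa_poly; last by case: pA.
  by rewrite addrA subrK.
rewrite add0r mulrDr -lecR -cabsE (le_trans (ler_normD _ _))// !cabsE -rmorphD lecR.
rewrite lerD// (le_trans (inner_le _ _))//.
  by rewrite mulrA ler_wpM2r ?nm_ge0// nmBC.
by rewrite mulrCA ler_wpM2l ?nm_ge0.
Qed.

(** From 0 <= f <= C follows |f - C/2| <= C/2, hence |f(A) - C/2| <= C/2, which bounds <f(A)x,x>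
    below by 0. *)
Lemma cfc_positive A f : positive A -> {within `[0, +oo[, continuous f} ->
  (forall s, 0 <= s -> 0 <= f s) -> positive (cfc f A).
Proof.
move=> pA cf f0; split=> [|x]; first exact: cfc_sa.
have M0 : 0 < opnorm A + 1 by rewrite ltr_wpDl ?opnorm_ge0.
have AM : opnorm A <= opnorm A + 1 by rewrite lerDl.
have [C C0 fC] := nonneg_bounded f _ cf (ltW M0).
have cC := nonneg_continuous_horner (C / 2)%:P.
have C2 : 0 <= C / 2 by rewrite divr_ge0.
have fC2 s : 0 <= s <= opnorm A + 1 -> `|f s - (C / 2)%:P.[s]| <= C / 2.
  move=> sM; have /andP[s0 _] := sM; rewrite hornerC ler_norml.
  have := fC _ sM; rewrite (ger0_norm (f0 _ s0)) => fsC; have := f0 _ s0; lra.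
have := cfc_le _ _ _ _ pA (nonneg_continuousB _ _ cf cC) M0 AM C2 fC2 x.
rewrite cfcB// (cfc_poly _ (horner (C / 2)%:P) (C / 2)%:P)// poly_opC => h.
have := rip_le (- ((cfc f A - (C / 2)%:C *: (1 : bop H)) x)) x.
rewrite nmN => /le_trans/(_ (ler_wpM2r (nm_ge0 x) h)).
rewrite !bopE !ripE ripxx => h2; lra.
Qed.

Lemma cfc_intertwine A B T f : positive A -> positive B ->
    {within `[0, +oo[, continuous f} -> T * A = B * T ->
  T * cfc f A = cfc f B * T.
Proof.
move=> pA pB cf TA; apply: bopP => x; apply/eqP; rewrite -subr_eq0; apply/eqP.
apply/nm_eq0/eqP; rewrite eq_le nm_ge0 andbT.
(* One M exceeds both norms, so a single polynomial approximates f at A and at B. *)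
pose M := opnorm A + opnorm B + 1.
have M0 : 0 < M by rewrite ltr_wpDl ?addr_ge0 ?opnorm_ge0.
have AM : opnorm A <= M by rewrite /M -addrA lerDl addr_ge0 ?opnorm_ge0.
have BM : opnorm B <= M by rewrite /M addrAC lerDr addr_ge0 ?opnorm_ge0.
apply: (le_eps _ _ _ (opnorm T * nm x + opnorm T * nm x)) => e e0.
have [p [pf pA']] := cfc_approx _ _ _ _ pA cf M0 AM e0.
have pB' := cfc_close _ _ _ _ _ pB cf BM (ltW e0) pf.
have -> : (T * cfc f A) x - (cfc f B * T) x =
    T (cfc f A x - poly_op p A x) + (poly_op p B (T x) - cfc f B (T x)).
  have -> : T (cfc f A x - poly_op p A x) = T (cfc f A x) - T (poly_op p A x).
    by rewrite linearB.
  by rewrite -[T (poly_op p A x)]bopM (poly_op_intertwine p A B)// !bopM addrA subrK.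
rewrite add0r mulrDr (le_trans (nmD _ _))// lerD//.
  by rewrite (le_trans (opnormP _ _))// mulrCA ler_wpM2l ?opnorm_ge0// nmBC.
by rewrite (le_trans (pB' _))// ler_wpM2l ?(ltW e0)// opnormP.
Qed.

End CalculusAlgebra.

(** * The mixed Schwarz and Buzano inequalities *)

Section MixedSchwarz.
Context {R : realType} {H : hilbertType R}.
Implicit Types (A B S T : bop H) (x y z : H) (r s c e : R) (f g h : R -> R).

Lemma positive_sqr S : selfadjoint S -> positive (S ^+ 2).
Proof.
move=> sS; split=> [|x]; first exact: saX.
by rewrite expr2 bopM sa_rip// ripxx sqr_ge0.
Qed.

Lemma rip_sqr S x : selfadjoint S -> rip ((S ^+ 2) x) x = nm (S x) ^+ 2.
Proof. by move=> sS; rewrite expr2 bopM sa_rip// ripxx. Qed.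

Lemma cfc_id A : positive A -> cfc id A = A.
Proof.
move=> pA; rewrite (cfc_poly _ _ 'X)// ?poly_opX// => [|s s0]; last by rewrite hornerX.
by apply: continuous_subspaceT => x; exact: cvg_id.
Qed.

Lemma positive_absop T : positive (absop T).
Proof.
apply: cfc_positive; [exact: positive_adjM|exact: nonneg_continuous_sqrt|].
by move=> s _; exact: sqrtr_ge0.
Qed.

Lemma absop_sqr T : absop T * absop T = adjoint T * T.
Proof.
have pA := positive_adjM T; have cs := @nonneg_continuous_sqrt R.
rewrite -cfcM// (cfc_poly _ _ 'X)// ?poly_opX//; first exact: nonneg_continuousM.
by move=> s s0; rewrite hornerX -expr2 sqr_sqrtr.
Qed.

Lemma nm_absop T x : nm (absop T x) = nm (T x).
Proof.
have [sP _] := positive_absop T.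
apply/eqP; rewrite -(eqrXn2 (n := 2)) ?nm_ge0// -!ripxx -sa_rip// -bopM absop_sqr.
by rewrite /rip bopM -adjointPV.
Qed.

(** The square root inherits the relation [T * (adjoint T * T) = (T * adjoint T) * T]. *)
Lemma absop_intertwine T : T * absop T = absop (adjoint T) * T.
Proof.
apply: cfc_intertwine; [exact: positive_adjM|exact: positive_adjM| |].
  exact: nonneg_continuous_sqrt.
by rewrite adjointK mulrA.
Qed.

(* For k(s) = 1 / (s + e), the contraction T k(|T|) stands in for the partial isometry
   of the polar decomposition: T h(|T|) k(|T|) g(|T|) = h(|T^*|) T k(|T|) g(|T|) tends
   to T with e. *)
Lemma mixed_schwarz T g h x y :
    {within `[0, +oo[, continuous g} -> {within `[0, +oo[, continuous h} ->
    (forall s, 0 <= s -> g s * h s = s) ->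
  cabs (inner (T x) y) <=
    nm (cfc g (absop T) x) * nm (cfc h (absop (adjoint T)) y).
Proof.
move=> cg ch gh; apply: (le_eps _ _ _ (nm x * nm y)) => e e0.
pose k s : R := (s + e)^-1; have ck := nonneg_continuousV _ e0.
set P := absop T; set Q := absop (adjoint T).
have pP : positive P by exact: positive_absop.
have pQ : positive Q by exact: positive_absop.
have cid : {within `[0, +oo[, continuous (id : R -> R)}.
  by apply: continuous_subspaceT => s; exact: cvg_id.
have ckg := nonneg_continuousM _ _ ck cg; have cr := nonneg_continuousM _ _ ch ckg.
have M0 : 0 < opnorm P + 1 by rewrite ltr_wpDl ?opnorm_ge0.
have PM : opnorm P <= opnorm P + 1 by rewrite lerDl.
set r := fun s => h s * (k s * g s) in cr.
have rE s : 0 <= s -> r s = s / (s + e).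
  by move=> s0; rewrite /r mulrCA [h s * _]mulrC gh// mulrC.
have TrE : T * cfc r P = cfc h Q * (T * (cfc k P * cfc g P)).
  rewrite cfcM// cfcM// mulrA.
  by rewrite (cfc_intertwine _ _ _ _ pP pQ ch (absop_intertwine T)) -!mulrA.
(* As |Tv| = | |T|v |, this is the bound s / (s + e) <= 1 in the calculus of |T|. *)
have contr z : nm (T (cfc k P z)) <= nm z.
  have -> : nm (T (cfc k P z)) = nm (cfc (fun s => id s * k s) P z).
    by rewrite (cfcM _ _ _ pP cid ck) (cfc_id _ pP) bopM nm_absop.
  rewrite -[leRHS]mul1r.
  apply: (cfc_le _ _ _ _ pP (nonneg_continuousM _ _ cid ck) M0 PM ler01) => s /andP[s0 _].
  have se : 0 < s + e by rewrite ltr_wpDl.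
  by rewrite ger0_norm ?divr_ge0 ?(ltW se)// ler_pdivrMr// mul1r lerDl ltW.
(* Likewise s - s r(s) = s e / (s + e) <= e. *)
have small : nm (T (x - cfc r P x)) <= e * nm x.
  have cpr := nonneg_continuousM _ _ cid cr.
  rewrite -nm_absop.
  have -> : P (x - cfc r P x) = cfc (fun s => id s - id s * r s) P x.
    rewrite (cfcB _ _ _ pP cid cpr) (cfcM _ _ _ pP cid cr) (cfc_id _ pP).
    by rewrite !bopE -linearB.
  apply: (cfc_le _ _ _ _ pP (nonneg_continuousB _ _ cid cpr) M0 PM (ltW e0)).
  move=> s /andP[s0 _] /=.
  have se : 0 < s + e by rewrite ltr_wpDl.
  have -> : s - s * r s = s * e / (s + e) by rewrite rE//; field; rewrite gt_eqF.
  rewrite ger0_norm ?divr_ge0 ?mulr_ge0 ?(ltW se) ?(ltW e0)//.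
  by rewrite ler_pdivrMr// mulrC ler_wpM2l ?(ltW e0)// lerDl ltW.
have -> : inner (T x) y = inner (T (cfc r P x)) y + inner (T (x - cfc r P x)) y.
  by rewrite -innerDl; congr (inner _ y); rewrite linearB addrC subrK.
rewrite (le_trans (cabsD _ _))// lerD//; last first.
  by rewrite (le_trans (inner_le _ _))// mulrA ler_wpM2r ?nm_ge0.
rewrite -[T _]bopM TrE !bopM cfc_sa// (le_trans (inner_le _ _))//.
by rewrite ler_wpM2r ?nm_ge0// contr.
Qed.

(* Cauchy-Schwarz for y and the reflection of x in the line of z. *)
Lemma buzano x y z : nm z = 1 -> rip x z * rip z y <= (nm x * nm y + rip x y) / 2.
Proof.
move=> z1; pose x' := (2 * rip x z)%:C *: z - x.
have nx' : nm x' = nm x.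
  apply/eqP; rewrite -(eqrXn2 (n := 2)) ?nm_ge0// -!ripxx.
  by rewrite /x' !ripE (ripC z x) !ripxx z1; apply/eqP; ring.
by have := rip_le x' y; rewrite nx' /x' !ripE => h; lra.
Qed.

Lemma numradiusP A x : nm x = 1 -> cabs (inner (A x) x) <= numradius A.
Proof.
move=> x1; apply: ub_le_sup; last by exists x => //=; rewrite nmE x1.
exists (opnorm A) => _ [y /= y1 <-]; rewrite -/(cabs _).
have {}y1 : nm y = 1 by rewrite /nm y1.
by rewrite (le_trans (inner_le _ _))// (le_trans (ler_wpM2r (nm_ge0 _) (opnormP _ _)))// y1 !mulr1.
Qed.

Lemma numradius_ge0 A : 0 <= numradius A.
Proof.
have [[x x1]|x0] := pselect (exists x : H, nm x = 1).
  exact: le_trans (cabs_ge0 _) (numradiusP A _ x1).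
(* Without unit vectors the supremum is over the empty set and equals 0. *)
rewrite /numradius (_ : [set _ | _ in _] = set0) ?sup0//.
by apply/seteqP; split=> // _ [x /= x1 _]; apply: x0; exists x; rewrite /nm x1.
Qed.

Lemma rip_opnorm A x : nm x = 1 -> rip (A x) x <= opnorm A.
Proof.
by move=> x1; rewrite (le_trans (rip_le _ _))// x1 mulr1 (le_trans (opnormP _ _))// x1 mulr1.
Qed.

End MixedSchwarz.

(** * Jensen's inequality and the numerical radius bound *)

Section Jensen.
Context {R : realType}.
Implicit Types (phi : R -> R) (a b m s t : R).

Lemma orlicz_convexE phi a b t : orlicz phi -> 0 <= a -> 0 <= b -> 0 <= t <= 1 ->
  phi (t * a + (1 - t) * b) <= t * phi a + (1 - t) * phi b.
Proof.
move=> [_ cphi _ _ _ _] a0 b0 /andP[t0 t1].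
have := cphi (Itv01 t0 t1) a b; rewrite !convRE /=; apply.
- by rewrite inE /= in_itv/= a0.
- by rewrite inE /= in_itv/= b0.
Qed.

Lemma orlicz_ge0 phi a : orlicz phi -> 0 <= a -> 0 <= phi a.
Proof.
move=> [_ _ _ p0 pp _]; rewrite le_eqVlt => /orP[/eqP<-|/pp/ltW//].
by rewrite p0.
Qed.

Lemma orlicz_le phi a b : orlicz phi -> 0 <= a -> a <= b -> phi a <= phi b.
Proof.
move=> [_ _ ip _ _ _] a0 ab; apply: ip => //; rewrite in_itv/= ?a0//.
by rewrite (le_trans a0).
Qed.

(** The slope k is the supremum of the chord slopes on the left of m, which convexity bounds by
    every chord slope on the right. Left chords exist because 0 < m. *)
Lemma supporting_line phi m : orlicz phi -> 0 < m ->
  exists k, forall s, 0 <= s -> phi m + k * (s - m) <= phi s.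
Proof.
move=> op m0.
have slopes s u : 0 <= s -> s < m -> m < u ->
    (phi m - phi s) / (m - s) <= (phi u - phi m) / (u - m).
  move=> s0 sm mu; have us : 0 < u - s by rewrite subr_gt0 (lt_trans sm).
  have ms : 0 < m - s by rewrite subr_gt0.
  have um : 0 < u - m by rewrite subr_gt0.
  (* This is the weight t with t s + (1 - t) u = m. *)
  have t01 : 0 <= (u - m) / (u - s) <= 1.
    by rewrite divr_ge0 ?(ltW um) ?(ltW us)//= ler_pdivrMr// mul1r lerD2l lerN2 ltW.
  have u0 : 0 <= u by rewrite (le_trans s0)// ltW// (lt_trans sm).
  have := orlicz_convexE _ _ _ _ op s0 u0 t01.
  have -> : (u - m) / (u - s) * s + (1 - (u - m) / (u - s)) * u = m.
    by field; rewrite gt_eqF.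
  have -> : (u - m) / (u - s) * phi s + (1 - (u - m) / (u - s)) * phi u =
      ((u - m) * phi s + (m - s) * phi u) / (u - s) by field; rewrite gt_eqF.
  rewrite ler_pdivlMr// => h.
  rewrite ler_pdivrMr// mulrAC ler_pdivlMr//; lra.
pose E := [set (phi m - phi s) / (m - s) | s in [set s | 0 <= s < m]].
have E0 : E !=set0 by exists ((phi m - phi 0) / (m - 0)), 0; rewrite //= lexx.
have Eu u : m < u -> ubound E ((phi u - phi m) / (u - m)).
  by move=> mu _ [s /= /andP[s0 sm] <-]; exact: slopes.
exists (sup E) => s s0; have [sm|ms|->] := ltgtP s m.
- have : (phi m - phi s) / (m - s) <= sup E.
    apply: ub_le_sup; last by exists s => //=; rewrite s0.
    by exists ((phi (m + 1) - phi m) / (m + 1 - m)); apply: Eu; rewrite ltrDl.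
  by rewrite ler_pdivrMr ?subr_gt0// => h; lra.
- have := ge_sup E0 (Eu _ ms); rewrite ler_pdivlMr ?subr_gt0// => h; lra.
- by rewrite subrr mulr0 addr0.
Qed.

(** With l a supporting line of phi at m = <Ax,x>, the operator phi(A) - l(A) is positive, and
    <l(A)x,x> = phi(m) for a unit vector x. *)
Lemma jensen_operator (H : hilbertType R) (A : bop H) phi x :
  orlicz phi -> positive A -> nm x = 1 -> phi (rip (A x) x) <= rip (cfc phi A x) x.
Proof.
move=> op pA x1; have [cp _ _ p0 _ _] := op.
(* At <Ax,x> = 0 positivity of phi(A) suffices, as phi(0) = 0. *)
have := pA.2 x; rewrite le_eqVlt => /orP[/eqP <-|m0].
  by rewrite p0; apply: (cfc_positive _ _ pA cp _).2 => s; exact: orlicz_ge0.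
have [k kP] := supporting_line _ _ op m0; set m := rip _ _ in m0 kP *.
pose l : {poly R} := (phi m - k * m)%:P + k *: 'X.
have lE s : l.[s] = phi m + k * (s - m) by rewrite !hornerE; ring.
have cl := nonneg_continuous_horner l.
have l_le s : 0 <= s -> 0 <= phi s - l.[s] by move=> s0; rewrite subr_ge0 lE kP.
have := (cfc_positive _ _ pA (nonneg_continuousB _ _ cp cl) l_le).2 x.
rewrite cfcB// (cfc_poly _ (horner l) l)// poly_opD poly_opC poly_opZ poly_opX.
by rewrite !bopE !ripE ripxx x1 -/m => h; lra.
Qed.

End Jensen.

(** * Bounds at a unit vector and the passage to the supremum *)

Section PointwiseBound.
Context {R : realType} {H : hilbertType R}.
Context (phi : R -> R) (op : orlicz phi).

Lemma midpoint_orlicz (a b : R) : 0 <= a -> 0 <= b ->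
  phi (2^-1 * a + (1 - 2^-1) * b) <= 2^-1 * (phi a + phi b).
Proof.
move=> a0 b0; have half : 0 <= (2^-1 : R) <= 1 by rewrite invr_ge0 ler0n/= invf_le1// ler1n.
by have := orlicz_convexE _ _ _ _ op a0 b0 half; lra.
Qed.

Lemma jensen_sum (A B : bop H) (x : H) : positive A -> positive B -> nm x = 1 ->
  phi (rip (A x) x) + phi (rip (B x) x) <= opnorm (cfc phi A + cfc phi B).
Proof.
move=> pA pB x1; rewrite (le_trans _ (rip_opnorm _ _ x1))// bopD ripDl.
by apply: lerD; exact: jensen_operator.
Qed.

Lemma fourth_power (S : bop H) : S ^+ 4 = (S ^+ 2) ^+ 2.
Proof. by rewrite -exprM. Qed.

(** Buzano's inequality for G^2 x, K^2 x and x bounds |<Tx,x>|^2 by the mean of |G^2 x| |K^2 x| and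
    <G^2 x,K^2 x>. The first is at most the mean of the forms of G^4 and K^4, the second at most the
    numerical radius; phi enters by two midpoint convexities and Jensen. *)
Lemma pointwise_quadratic_bound (G K T : bop H) (x : H) :
    selfadjoint G -> selfadjoint K -> nm x = 1 ->
    cabs (inner (T x) x) <= nm (G x) * nm (K x) ->
  phi (2^-1 * (2^-1 * rip ((G ^+ 4) x) x + (1 - 2^-1) * rip ((K ^+ 4) x) x)
      + (1 - 2^-1) * numradius (K ^+ 2 * G ^+ 2)) <=
    2^-1 * (2^-1 * opnorm (cfc phi (G ^+ 4) + cfc phi (K ^+ 4))
      + phi (numradius (K ^+ 2 * G ^+ 2))) /\
  cabs (inner (T x) x) ^+ 2 <=
    2^-1 * (2^-1 * rip ((G ^+ 4) x) x + (1 - 2^-1) * rip ((K ^+ 4) x) x)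
      + (1 - 2^-1) * numradius (K ^+ 2 * G ^+ 2).
Proof.
move=> sG sK x1 uGK.
have sG2 := saX 2 _ sG; have sK2 := saX 2 _ sK.
have pG4 := positive_sqr _ sG2; have pK4 := positive_sqr _ sK2.
have J := jensen_sum _ _ _ pG4 pK4 x1.
have gaE := rip_sqr _ x sG2; have deE := rip_sqr _ x sK2.
have alE := rip_sqr _ x sG; have beE := rip_sqr _ x sK.
have kw : rip ((G ^+ 2) x) ((K ^+ 2) x) <= numradius (K ^+ 2 * G ^+ 2).
  rewrite -sa_rip// -bopM (le_trans (ler_norm _))// (le_trans (Re_le_cabs _))//.
  exact: numradiusP.
have bz := buzano ((G ^+ 2) x) ((K ^+ 2) x) x x1.
rewrite [rip x _]ripC alE beE in bz.
rewrite !fourth_power gaE deE in J *.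
have w0 := numradius_ge0 (K ^+ 2 * G ^+ 2).
have u0 := cabs_ge0 (inner (T x) x).
have [nG nK] := (nm_ge0 (G x), nm_ge0 (K x)).
move: J kw bz w0 u0 uGK.
(* Only real numbers remain: u = |<Tx,x>|, the norms a, b, c, d of G x, K x, G^2 x, K^2 x, and r =
   Re <G^2 x,K^2 x>. *)
move: (opnorm _) (numradius _) (cabs _) (nm (G x)) (nm (K x)) (nm ((G ^+ 2) x)) (nm ((K ^+ 2) x))
  (rip _ _) nG nK => N w u a b c d r a0 b0 J kw bz w0 u0 uab.
have cd : 0 <= 2^-1 * c ^+ 2 + (1 - 2^-1) * d ^+ 2.
  by have := sqr_ge0 c; have := sqr_ge0 d; lra.
split.
  have := midpoint_orlicz _ _ cd w0; have := midpoint_orlicz _ _ (sqr_ge0 c) (sqr_ge0 d).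
  lra.
have h1 : u ^+ 2 <= (a * b) ^+ 2 by rewrite ler_pXn2r ?nnegrE// mulr_ge0.
by rewrite exprMn in h1; have := sqr_ge0 (c - d); rewrite sqrrB => h2; lra.
Qed.

(** One factor |<Tx,x>| is bounded by w(T), the other by the mean of |Gx|^2 and |Kx|^2.
    Submultiplicativity separates them under phi, then convexity and Jensen treat the mean. *)
Lemma pointwise_linear_bound (G K T : bop H) (x : H) : submultiplicative phi ->
    selfadjoint G -> selfadjoint K -> nm x = 1 ->
    cabs (inner (T x) x) <= nm (G x) * nm (K x) ->
  phi (cabs (inner (T x) x) ^+ 2) <=
    phi (numradius T) * (2^-1 * opnorm (cfc phi (G ^+ 2) + cfc phi (K ^+ 2))).
Proof.
move=> sub sG sK x1 uGK.
have J := jensen_sum _ _ _ (positive_sqr _ sG) (positive_sqr _ sK) x1.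
have uW := numradiusP T _ x1; have W0 := numradius_ge0 T.
have u0 := cabs_ge0 (inner (T x) x).
rewrite !rip_sqr// in J.
move: J uW W0 u0 uGK.
move: (opnorm _) (numradius _) (cabs _) (nm (G x)) (nm (K x)) => N W u a b J uW W0 u0 uab.
have ab0 : 0 <= 2^-1 * a ^+ 2 + (1 - 2^-1) * b ^+ 2.
  by have := sqr_ge0 a; have := sqr_ge0 b; lra.
have u2 : u ^+ 2 <= W * (2^-1 * a ^+ 2 + (1 - 2^-1) * b ^+ 2).
  rewrite expr2 ler_pM// (le_trans uab)//.
  have := sqr_ge0 (a - b); rewrite sqrrB => h2; lra.
rewrite (le_trans (orlicz_le _ _ _ op (sqr_ge0 u) u2))//.
rewrite (le_trans (sub _ _ W0 ab0))// ler_wpM2l ?orlicz_ge0//.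
by have := midpoint_orlicz _ _ (sqr_ge0 a) (sqr_ge0 b); lra.
Qed.

(** Unit vectors with |<Tx,x>| close to w(T) carry the bound to the supremum, by continuity of phi
    at w(T)^2. The case w(T) = 0 covers the zero space. *)
Lemma orlicz_numradius_le (T : bop H) (c : R) : 0 <= c ->
    (forall x, nm x = 1 -> phi (cabs (inner (T x) x) ^+ 2) <= c) ->
  phi (numradius T ^+ 2) <= c.
Proof.
move=> c0 key; set W := numradius T; have W0 : 0 <= W := numradius_ge0 T.
have [W00|W00] := eqVneq W 0; first by rewrite W00 expr0n/= (orlicz0 op).
have Wp : 0 < W by rewrite lt_neqAle eq_sym W00.
apply/ler_addgt0Pr => e e0.
have [d d0 hd] := nonneg_continuousP _ (orlicz_cont op) _ _ (sqr_ge0 W) e0.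
(* A set without a supremum would give the default value 0, so W != 0 provides one. *)
have hs : has_sup [set complex.Re `|inner (T x) x| | x in [set x : H | `|x| = 1]].
  by apply: contrapT => /sup_out ns; rewrite /W /numradius ns eqxx in W00.
(* Since W + u <= 2 W, a gap W - u below d / (2 W) puts u^2 within d of W^2. *)
pose d' := Num.min (d / (2 * W)) W.
have d'0 : 0 < d' by rewrite lt_min Wp andbT divr_gt0// mulr_gt0.
have [_ [x /= x1 <-] ux] := sup_adherent d'0 hs.
have {}ux : W - d' < cabs (inner (T x) x) by exact: ux.
have {}x1 : nm x = 1 by rewrite /nm x1.
have := key x x1; have := numradiusP T _ x1; have := cabs_ge0 (inner (T x) x).
rewrite -/W; move: (cabs _) ux => u ux u0 uW uc.
have : `|phi (W ^+ 2) - phi (u ^+ 2)| < e.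
  apply: hd; first exact: sqr_ge0.
  have d'W : d' * (2 * W) <= d by rewrite -ler_pdivlMr ?mulr_gt0// ge_min lexx.
  have Wu : W - u < d' by rewrite ltrBlDr -ltrBlDl.
  rewrite subr_sqr ger0_norm ?mulr_ge0 ?subr_ge0 ?addr_ge0//.
  apply: lt_le_trans d'W; rewrite (@le_lt_trans _ _ ((W - u) * (2 * W)))//.
    by rewrite ler_wpM2l ?subr_ge0// mulr_natl mulr2n lerD2l.
  by rewrite ltr_pM2r ?mulr_gt0.
by rewrite ltr_norml => /andP[_ ?]; lra.
Qed.

End PointwiseBound.

Theorem theorem2p14 (R : realType) (H : hilbertType R) (T : bop H)
    (g h : R -> R)
    (g_ge0 : forall s, 0 <= s -> 0 <= g s)
    (h_ge0 : forall s, 0 <= s -> 0 <= h s)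
    (g_cont : {within `[0, +oo[, continuous g})
    (h_cont : {within `[0, +oo[, continuous h})
    (gh : forall s, 0 <= s -> g s * h s = s)
    (f : R -> R) (f_ge0 : forall s, 0 < s < 1 -> 0 <= f s)
    (t : R) (t01 : 0 < t < 1)
    (phi : R -> R) (phi_orlicz : orlicz phi)
    (phi_submult : submultiplicative phi) :
  phi (numradius T ^+ 2) <=
    f t / (4 * (1 + f t)) *
      opnorm (cfc phi (cfc g (absop T) ^+ 4)
              + cfc phi (cfc h (absop (adjoint T)) ^+ 4))
    + f t / (2 * (1 + f t)) *
      phi (numradius (cfc h (absop (adjoint T)) ^+ 2 * cfc g (absop T) ^+ 2))
    + 1 / (2 * (1 + f t)) * phi (numradius T) *
      opnorm (cfc phi (cfc g (absop T) ^+ 2)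
              + cfc phi (cfc h (absop (adjoint T)) ^+ 2)).
Proof.
have F0 := f_ge0 t t01; have f1 : 0 < 1 + f t by rewrite ltr_wpDr.
have sG := cfc_sa _ _ (positive_absop T) g_cont.
have sK := cfc_sa _ _ (positive_absop (adjoint T)) h_cont.
have MS x := mixed_schwarz T g h x x g_cont h_cont gh.
(* With 1 - th = 1 / (1 + f t), the coefficients of the statement are th and 1 - th times factors
   1/2 and 1/4. *)
pose th := f t / (1 + f t).
have th01 : 0 <= th <= 1 by rewrite divr_ge0 ?(ltW f1)//= ler_pdivrMr// mul1r lerDr.
have [th0 th1] := andP th01.
have phi0 (A : bop H) : 0 <= phi (numradius A) by rewrite orlicz_ge0// numradius_ge0.
have arith (N1 N2 p q : R) : th * (2^-1 * (2^-1 * N1 + p)) + (1 - th) * (q * (2^-1 * N2)) =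
    f t / (4 * (1 + f t)) * N1 + f t / (2 * (1 + f t)) * p
      + 1 / (2 * (1 + f t)) * q * N2.
  by rewrite /th; field; rewrite gt_eqF.
rewrite -arith; apply: orlicz_numradius_le => // [|x x1].
  apply: addr_ge0; apply: mulr_ge0; rewrite ?subr_ge0//; apply: mulr_ge0 => //.
    by rewrite addr_ge0// mulr_ge0 ?opnorm_ge0.
  by rewrite mulr_ge0 ?opnorm_ge0.
have [b1 u2] := pointwise_quadratic_bound _ phi_orlicz _ _ _ _ sG sK x1 (MS x).
have b2 := pointwise_linear_bound _ phi_orlicz _ _ _ _ phi_submult sG sK x1 (MS x).
have u0 := sqr_ge0 (cabs (inner (T x) x)).
(* The share of weight th receives the quadratic bound, the share of weight 1 - th the linear
   one. *)
have -> : cabs (inner (T x) x) ^+ 2 =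
    th * cabs (inner (T x) x) ^+ 2 + (1 - th) * cabs (inner (T x) x) ^+ 2 by ring.
rewrite (le_trans (orlicz_convexE _ _ _ _ phi_orlicz u0 u0 th01))//.
rewrite lerD// ler_wpM2l ?subr_ge0//.
exact: le_trans (orlicz_le _ _ _ phi_orlicz u0 u2) b1.
Qed.
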